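(* Let $(X,G)$ be a minimal topological dynamical system, where $G$ is amenable, and let $\mathcal F=\{F_n\}_{n\ge1}$ be a Følner sequence of $G$. If $(X,G)$ satisfies the local Bronstein condition, then every mean-sensitive $K$-tuple along $\mathcal F$ is a $K$-IT-tuple, for every $K\in\mathbb N$ with $K\ge 2$.
   Context: $G$ is an infinite countable discrete group; a tds $(X,G)$ is a compact metric space $(X,d)$ with a $G$-action by homeomorphisms; minimal means no proper nonempty closed invariant subset; a minimal point is one with minimal orbit closure. $RP_2(X,G)$ is the set of $(x_1,x_2)$ such that for every $\epsilon>0$ there are $x_1',x_2'\in X$ and $g\in G$ with $d(x_k,x_k')\le\epsilon$ and $d(gx_1',gx_2')\le\epsilon$. Local Bronstein condition: whenever $(x,x')\in RP_2(X,G)$ is a minimal point of $(X\times X,G)$, there exist minimal points $(x_n,x_n')$ of $(X\times X,G)$ and $g_n\in G$ with $(x_n,x_n')\to(x,x')$ and $d(g_nx_n,g_nx_n')\to0$. A tuple $(x_1,\dots,x_K)\in X^K$ is a mean-sensitive $K$-tuple along $\mathcal F$ if for all open neighborhoods $U_k$ of $x_k$ there is $\delta>0$ such that for every nonempty open $U\subset X$ there exist $y_1,\dots,y_K\in U$ with $\limsup_{n\to\infty}\frac{1}{|F_n|}|\{g\in F_n: gy_k\in U_k\text{ for }1\le k\le K\}|>\delta$. A $K$-IT-tuple is $(x_1,\dots,x_K)$ such that for all open neighborhoods $U_k\ni x_k$ there is an infinite $J\subset G$ with $\bigcap_{g\in I}g^{-1}U_{\sigma(g)}\neq\emptyset$ for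 every nonempty finite $I\subset J$ and every $\sigma:I\to\{1,\dots,K\}$. *)

(* Defs.v *)
From Stdlib Require Import Reals List Classical ClassicalEpsilon.
From Coquelicot Require Import Coquelicot.
Open Scope R_scope.

Record Group := {
  gcar :> Type;
  gmul : gcar -> gcar -> gcar;
  gone : gcar;
  ginv : gcar -> gcar;
  gmulA : forall x y z, gmul x (gmul y z) = gmul (gmul x y) z;
  gmul1l : forall x, gmul gone x = x;
  gmulVl : forall x, gmul (ginv x) x = gone
}.

Definition countable_group (G : Group) : Prop :=
  exists f : nat -> G, forall g : G, exists n, f n = g.
Definition infinite_group (G : Group) : Prop :=
  forall l : list G, exists g : G, ~ In g l.

Definition countP {T : Type} (P : T -> Prop) (l : list T) : nat :=
  length (filter (fun t => if excluded_middle_informative (P t) then true else false) l).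

Definition sym_diff_card (G : Group) (g : G) (F : list G) : nat :=
  (countP (fun h => ~ In (gmul G g h) F) F             (* |gF \ F| *)
   + countP (fun h => ~ In (gmul G (ginv G g) h) F) F)%nat. (* |F \ gF| *)

Definition Folner (G : Group) (F : nat -> list G) : Prop :=
  (forall n, NoDup (F n) /\ F n <> nil) /\
  forall g : G, Un_cv (fun n => INR (sym_diff_card G g (F n)) / INR (length (F n))) 0.

Definition amenable (G : Group) : Prop := exists F : nat -> list G, Folner G F.

Record MetricSpace := {
  mcar :> Type;
  mdist : mcar -> mcar -> R;
  mdist_eq0 : forall x y, mdist x y = 0 <-> x = y;
  mdist_sym : forall x y, mdist x y = mdist y x;
  mdist_tri : forall x y z, mdist x z <= mdist x y + mdist y z
}.

Section Topology.
Variable X : MetricSpace.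
Notation d := (mdist X).

Definition mopen (U : X -> Prop) : Prop :=
  forall x, U x -> exists r, r > 0 /\ forall y, d x y < r -> U y.

Definition mopen2 (U : X * X -> Prop) : Prop :=
  forall p, U p -> exists r, r > 0 /\
    forall q, d (fst p) (fst q) < r -> d (snd p) (snd q) < r -> U q.

Definition mcompact : Prop :=
  forall (I : Type) (V : I -> X -> Prop), (forall i, mopen (V i)) ->
    (forall x, exists i, V i x) ->
    exists l : list I, forall x, exists i, In i l /\ V i x.
End Topology.

Section Dyn.
Variables (G : Group) (T : Type) (op : (T -> Prop) -> Prop) (act : G -> T -> T).

Definition tclosed (A : T -> Prop) : Prop := op (fun x => ~ A x).
Definition invariant (A : T -> Prop) : Prop := forall g x, A x -> A (act g x).

Definition minimal_set (Y : T -> Prop) : Prop :=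
  tclosed Y /\ invariant Y /\ (exists y, Y y) /\
  forall A : T -> Prop, tclosed A -> invariant A -> (exists y, A y) ->
    (forall y, A y -> Y y) -> forall y, Y y -> A y.

Definition orbit_closure (x : T) : T -> Prop :=
  fun y => forall U, op U -> U y -> exists g, U (act g x).

Definition minimal_point (x : T) : Prop := minimal_set (orbit_closure x).

Definition minimal_system : Prop := minimal_set (fun _ => True).
End Dyn.

Definition tds (G : Group) (X : MetricSpace) (act : G -> X -> X) : Prop :=
  mcompact X /\
  (forall x, act (gone G) x = x) /\
  (forall g h x, act (gmul G g h) x = act g (act h x)) /\
  (forall g x eps, eps > 0 -> exists del, del > 0 /\
     forall y, mdist X x y < del -> mdist X (act g x) (act g y) < eps).

Definition act2 (G : Group) (X : MetricSpace) (act : G -> X -> X) (g : G) (p : X * X) : X * X :=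
  (act g (fst p), act g (snd p)).

Definition RP2 (G : Group) (X : MetricSpace) (act : G -> X -> X) (x1 x2 : X) : Prop :=
  forall eps, eps > 0 -> exists x1' x2' (g : G),
    mdist X x1 x1' <= eps /\ mdist X x2 x2' <= eps /\
    mdist X (act g x1') (act g x2') <= eps.

Definition minimal_point2 (G : Group) (X : MetricSpace) (act : G -> X -> X) (p : X * X) : Prop :=
  minimal_point G (X * X) (mopen2 X) (act2 G X act) p.

Definition local_Bronstein (G : Group) (X : MetricSpace) (act : G -> X -> X) : Prop :=
  forall x x' : X, RP2 G X act x x' -> minimal_point2 G X act (x, x') ->
    exists (xs xs' : nat -> X) (gs : nat -> G),
      (forall n, minimal_point2 G X act (xs n, xs' n)) /\
      Un_cv (fun n => mdist X (xs n) x) 0 /\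
      Un_cv (fun n => mdist X (xs' n) x') 0 /\
      Un_cv (fun n => mdist X (act (gs n) (xs n)) (act (gs n) (xs' n))) 0.

(** K-tuples are represented as x : nat -> X, using indices 0 .. K-1. *)
Definition mean_sensitive_tuple (G : Group) (X : MetricSpace) (act : G -> X -> X)
    (F : nat -> list G) (K : nat) (x : nat -> X) : Prop :=
  forall U : nat -> X -> Prop,
    (forall k, (k < K)%nat -> mopen X (U k) /\ U k (x k)) ->
    exists del, del > 0 /\
      forall U0 : X -> Prop, mopen X U0 -> (exists z, U0 z) ->
        exists y : nat -> X, (forall k, (k < K)%nat -> U0 (y k)) /\
          Rbar_lt (Finite del)
            (LimSup_seq (fun n =>
               INR (countP (fun g => forall k, (k < K)%nat -> U k (act g (y k))) (F n))
               / INR (length (F n)))).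

Definition IT_tuple (G : Group) (X : MetricSpace) (act : G -> X -> X)
    (K : nat) (x : nat -> X) : Prop :=
  forall U : nat -> X -> Prop,
    (forall k, (k < K)%nat -> mopen X (U k) /\ U k (x k)) ->
    exists J : G -> Prop,
      (forall l : list G, exists g, J g /\ ~ In g l) /\
      forall (I : list G) (sigma : G -> nat),
        I <> nil -> (forall g, In g I -> J g) ->
        (forall g, In g I -> (sigma g < K)%nat) ->
        exists z : X, forall g, In g I -> U (sigma g) (act g z).

(* Main.v *)
Require Import Defs.
From Stdlib Require Import Reals List Classical ClassicalEpsilon FunctionalExtensionality FinFun Lra Lia.
From Coquelicot Require Import Coquelicot.
From mathcomp Require classical_sets filter.
Open Scope R_scope.

(** Continuous [G]-invariant pseudometrics on [X] stand for the maximal equicontinuous factor.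

    McMahon's argument: for an invariant mean on a [G]-set [Z], the mean of the fibres of an
    invariant family of subsets of [Z] over [X] is constant by minimality, so the mean of symmetric
    differences of fibres is a continuous invariant pseudometric. Hence open sets [E_i] contained in
    the closures of open sets [D_i] for the invariant pseudometrics can be moved simultaneously, by
    one and the same [g], so that every [g E_i] meets [D_i].

    By unique ergodicity of the equicontinuous factor, mean sensitivity says that the images of
    the neighbourhoods [U_k] there have an intersection [A] of positive Haar measure. An
    independence set for the [U_k] is built one element at a time: one keeps open sets [O_s], indexed
    by the [K]-valued words chosen so far, with points [p_s] in the interiors of their images in the
    factor, such that a set of [g] of positive density brings all [p_s] into [A]. Such a [g] puts
    [g p_s] in the closure of the interior of the image of each [U_k], so [p_s] can be perturbed
    to points [p_{s,k}] with [g p_{s,k}] in that interior, and McMahon's argument yields one [h] for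
    which all [h O_s] meet all [U_k]. Positivity of the density survives small perturbations since the
    measure of [A] is the limit of the measures of its neighbourhoods. *)

(** * Generalized limits *)

(** The ultrafilter lemma extends the filter of cofinite sets; the first clause is its freeness. *)
Lemma free_ultrafilter_exists : exists U : (nat -> Prop) -> Prop,
  (forall N, U (fun n => (N <= n)%nat)) /\
  (forall A B : nat -> Prop, (forall n, A n -> B n) -> U A -> U B) /\
  (forall A B, U A -> U B -> U (fun n => A n /\ B n)) /\
  (forall A, U A -> exists n, A n) /\
  (forall A, U A \/ U (fun n => ~ A n)).
Proof.
set (F := fun A : nat -> Prop => exists N, forall n, (N <= n)%nat -> A n).
assert (PF : filter.ProperFilter (F : classical_sets.set_system nat)).
{ split.
  - intros [N HN]. exact (HN N (le_n N)).
  - split.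
    + exists 0%nat. intros; exact I.
    + intros A B [N HN] [M HM]. exists (max N M). intros n Hn. split.
      apply HN; lia. apply HM; lia.
    + intros A B AB [N HN]. exists N. intros n Hn. exact (AB n (HN n Hn)). }
destruct (filter.ultraFilterLemma PF) as [U [UU FU]].
assert (PU : filter.ProperFilter U) by exact (@filter.ultra_proper _ _ UU).
destruct PU as [Une [UT UI US]].
exists U. split; [|split; [|split; [|split]]].
- intros N. apply FU. exists N. auto.
- intros A B AB. apply US. exact AB.
- intros A B. apply UI.
- intros A UA. apply NNPP. intros H. apply Une. revert UA. apply US.
  intros n An. apply H. exists n. exact An.
- intros A. exact (filter.in_ultra_setVsetC A UU).
Qed.

Definition bounded_seq (u : nat -> R) := exists B, forall n, Rabs (u n) <= B.

(** Limits along a free ultrafilter. Freeness makes initial terms irrelevant, so asymptotic Folner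
    invariance becomes exact invariance of the means built from [lim]. *)
Lemma generalized_limit_exists : exists lim : (nat -> R) -> R,
  (forall u v, bounded_seq u -> bounded_seq v ->
     (exists N, forall n, (N <= n)%nat -> u n <= v n) -> lim u <= lim v) /\
  (forall u v, bounded_seq u -> bounded_seq v -> lim (fun n => u n + v n) = lim u + lim v) /\
  (forall c, lim (fun _ => c) = c) /\
  (forall u v, bounded_seq u -> bounded_seq v -> Un_cv (fun n => u n - v n) 0 -> lim u = lim v).
Proof.
destruct free_ultrafilter_exists as [U [Uev [Usub [Uint [Une Uor]]]]].
assert (Hex : forall u, exists l, bounded_seq u ->
   forall e, e > 0 -> U (fun n => Rabs (u n - l) < e)).
{ intros u. destruct (classic (bounded_seq u)) as [[B HB]|nb].
  2: exists 0; intros; contradiction.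
  (* The limit is the supremum of the numbers below [u n] for ultrafilter-many [n]. *)
  set (S := fun a => U (fun n => a <= u n)).
  destruct (completeness S) as [l [lub1 lub2]].
  - exists B. intros a Ha. destruct (Une _ Ha) as [n Hn].
    generalize (HB n) (Rle_abs (u n)). lra.
  - exists (-B). apply (Usub (fun n => (0 <= n)%nat)); [|apply Uev].
    intros n _. generalize (HB n) (Rcomplements.Rabs_maj2 (u n)). lra.
  - exists l. intros _ e He.
    assert (H1 : U (fun n => u n < l + e)).
    { destruct (Uor (fun n => l + e <= u n)) as [H|H].
      - generalize (lub1 _ H). lra.
      - apply (Usub _ _ (fun n (h : ~ (l + e <= u n)) => Rnot_le_lt _ _ h) H). }
    assert (H2 : exists a, S a /\ l - e < a).
    { apply NNPP. intros H. assert (l <= l - e); [|lra].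
      apply lub2. intros a Ha. apply Rnot_lt_le. intros h. apply H. exists a. auto. }
    destruct H2 as [a [Sa La]].
    apply (Usub _ _ (fun n (h : u n < l + e /\ a <= u n) =>
       Rabs_def1 (u n - l) e ltac:(lra) ltac:(lra))).
    apply Uint; assumption. }
set (lim := fun u => proj1_sig (constructive_indefinite_description _ (Hex u))).
assert (Hlim : forall u, bounded_seq u -> forall e, e > 0 -> U (fun n => Rabs (u n - lim u) < e)).
{ intros u. exact (proj2_sig (constructive_indefinite_description _ (Hex u))). }
clearbody lim.
assert (bc : forall c, bounded_seq (fun _ => c)) by (intros c; exists (Rabs c); intros; lra).
exists lim. split; [|split; [|split]].
- intros u v bu bv [N HN]. apply Rnot_lt_le. intros H.
  set (e := (lim u - lim v) / 2).
  assert (He : e > 0) by (unfold e; lra).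
  destruct (Une _ (Uint _ _ (Uev N) (Uint _ _ (Hlim u bu e He) (Hlim v bv e He)))) as [n [Hn [H1 H2]]].
  apply Rabs_def2 in H1. apply Rabs_def2 in H2. specialize (HN n Hn). unfold e in *. lra.
- intros u v bu bv.
  assert (buv : bounded_seq (fun n => u n + v n)).
  { destruct bu as [B HB]. destruct bv as [C HC]. exists (B + C). intros n.
    generalize (Rabs_triang (u n) (v n)) (HB n) (HC n). lra. }
  apply cond_eq. intros e He.
  assert (He3 : e / 3 > 0) by lra.
  destruct (Une _ (Uint _ _ (Hlim _ buv _ He3) (Uint _ _ (Hlim u bu _ He3) (Hlim v bv _ He3))))
    as [n [H0 [H1 H2]]].
  apply Rabs_def2 in H1. apply Rabs_def2 in H2. apply Rabs_def2 in H0.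
  apply Rabs_def1; lra.
- intros c. apply cond_eq. intros e He.
  destruct (Une _ (Hlim _ (bc c) e He)) as [n Hn].
  rewrite Rabs_minus_sym. exact Hn.
- intros u v bu bv cv. apply cond_eq. intros e He.
  assert (He3 : e / 3 > 0) by lra.
  destruct (cv _ He3) as [N HN].
  destruct (Une _ (Uint _ _ (Uev N) (Uint _ _ (Hlim u bu _ He3) (Hlim v bv _ He3))))
    as [n [H0 [H1 H2]]].
  specialize (HN n H0). unfold R_dist in HN.
  apply Rabs_def2 in H1. apply Rabs_def2 in H2. apply Rabs_def2 in HN.
  apply Rabs_def1; lra.
Qed.

(** * Averages over finite sets *)

Fixpoint sumL {T : Type} (f : T -> R) (l : list T) : R :=
  match l with nil => 0 | x :: l' => f x + sumL f l' end.

Definition avg {T : Type} (l : list T) (f : T -> R) : R := sumL f l / INR (length l).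

Definition ind (P : Prop) : R := if excluded_middle_informative P then 1 else 0.

Lemma ind_true (P : Prop) : P -> ind P = 1.
Proof. intros p. unfold ind. destruct (excluded_middle_informative P); tauto. Qed.

Lemma ind_false (P : Prop) : ~ P -> ind P = 0.
Proof. intros p. unfold ind. destruct (excluded_middle_informative P); tauto. Qed.

Lemma ind_range (P : Prop) : 0 <= ind P <= 1.
Proof. unfold ind. destruct (excluded_middle_informative P); lra. Qed.

Lemma ind_le (P Q : Prop) : (P -> Q) -> ind P <= ind Q.
Proof.
intros H. unfold ind.
destruct (excluded_middle_informative P); destruct (excluded_middle_informative Q); try lra; tauto.
Qed.

Lemma sumL_ind_countP {T : Type} (P : T -> Prop) l : sumL (fun t => ind (P t)) l = INR (countP P l).
Proof.
induction l as [|a l IH]; [reflexivity|]. simpl. rewrite IH.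
unfold countP. simpl. unfold ind. destruct (excluded_middle_informative (P a)); [|lra].
simpl length. rewrite S_INR. lra.
Qed.

Section SumL.
Context {T : Type}.
Implicit Types (f h : T -> R) (l : list T).

Lemma sumL_le f h l : (forall x, In x l -> f x <= h x) -> sumL f l <= sumL h l.
Proof.
induction l as [|a l IH]; simpl; intros H; [lra|].
generalize (H a (or_introl eq_refl)) (IH (fun x hx => H x (or_intror hx))). lra.
Qed.

Lemma sumL_ext f h l : (forall x, In x l -> f x = h x) -> sumL f l = sumL h l.
Proof. intros H. apply Rle_antisym; apply sumL_le; intros x Hx; rewrite (H x Hx); lra. Qed.

Lemma sumL_plus f h l : sumL (fun x => f x + h x) l = sumL f l + sumL h l.
Proof. induction l as [|a l IH]; simpl; [|rewrite IH]; lra. Qed.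

Lemma sumL_scal c f l : sumL (fun x => c * f x) l = c * sumL f l.
Proof. induction l as [|a l IH]; simpl; [|rewrite IH]; lra. Qed.

Lemma sumL_const c l : sumL (fun _ : T => c) l = c * INR (length l).
Proof. induction l as [|a l IH]; [simpl; lra|]. simpl length. rewrite S_INR. simpl. rewrite IH. lra. Qed.

Lemma sumL_nonneg f l : (forall x, 0 <= f x) -> 0 <= sumL f l.
Proof.
intros H. apply Rle_trans with (sumL (fun _ : T => 0) l).
- rewrite sumL_const. lra.
- apply sumL_le. intros; apply H.
Qed.

Lemma sumL_mem f l x : (forall y, 0 <= f y) -> In x l -> f x <= sumL f l.
Proof.
intros Hf. induction l as [|a l IH]; simpl; [tauto|].
intros [->|Hx].
- generalize (sumL_nonneg f l Hf). lra.
- generalize (IH Hx) (Hf a). lra.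
Qed.

Lemma sumL_app f l l' : sumL f (l ++ l') = sumL f l + sumL f l'.
Proof. induction l as [|a l IH]; simpl; [|rewrite IH]; lra. Qed.

Lemma sumL_incl f l l' : (forall x, 0 <= f x) -> NoDup l -> incl l l' -> sumL f l <= sumL f l'.
Proof.
intros Hf. revert l'. induction l as [|a l IH]; intros l' nd inc; simpl.
- apply sumL_nonneg, Hf.
- inversion nd as [|? ? na ndl]; subst.
  destruct (in_split a l' (inc a (or_introl eq_refl))) as [l1 [l2 ->]].
  assert (Hi : incl l (l1 ++ l2)).
  { intros x Hx. assert (Hx' := inc x (or_intror Hx)).
    apply in_app_iff in Hx'. apply in_app_iff. destruct Hx' as [?|[->|?]]; tauto. }
  generalize (IH _ ndl Hi). rewrite !sumL_app. simpl. lra.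
Qed.

Variable l : list T.
Hypothesis l_nonempty : l <> nil.

Lemma INR_length_pos : 0 < INR (length l).
Proof. destruct l; [tauto|]. apply lt_0_INR. simpl. lia. Qed.

Lemma avg_le f h : (forall x, In x l -> f x <= h x) -> avg l f <= avg l h.
Proof.
intros H. unfold avg. apply Rmult_le_compat_r; [|apply sumL_le, H].
left. apply Rinv_0_lt_compat, INR_length_pos.
Qed.

Lemma avg_ext f h : (forall x, In x l -> f x = h x) -> avg l f = avg l h.
Proof. intros H. unfold avg. f_equal. apply sumL_ext, H. Qed.

Lemma avg_plus f h : avg l (fun x => f x + h x) = avg l f + avg l h.
Proof. unfold avg. rewrite sumL_plus. unfold Rdiv. ring. Qed.

Lemma avg_scal c f : avg l (fun x => c * f x) = c * avg l f.
Proof. unfold avg. rewrite sumL_scal. unfold Rdiv. ring. Qed.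

Lemma avg_const c : avg l (fun _ => c) = c.
Proof. unfold avg. rewrite sumL_const. field. generalize INR_length_pos. lra. Qed.

Lemma avg_range f a b : (forall x, a <= f x <= b) -> a <= avg l f <= b.
Proof.
intros H. split.
- rewrite <- (avg_const a). apply avg_le. intros; apply H.
- rewrite <- (avg_const b). apply avg_le. intros; apply H.
Qed.

Lemma avg_ind_pos (A : T -> Prop) : 0 < avg l (fun x => ind (A x)) -> exists x, In x l /\ A x.
Proof.
intros H. apply NNPP. intros Hn.
assert (avg l (fun x => ind (A x)) = 0); [|lra].
rewrite (avg_ext _ (fun _ => 0)); [apply avg_const|].
intros x Hx. apply ind_false. intros HA. apply Hn. exists x. auto.
Qed.

End SumL.

Lemma sumL_exchange {S T : Type} (k : T -> S -> R) (l : list T) (l' : list S) :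
  sumL (fun x => sumL (k x) l') l = sumL (fun y => sumL (fun x => k x y) l) l'.
Proof.
induction l as [|a l IH]; simpl.
- rewrite sumL_const. lra.
- rewrite IH, <- sumL_plus. reflexivity.
Qed.

Lemma sumL_map {S T : Type} (f : T -> R) (p : S -> T) (l : list S) : sumL f (map p l) = sumL (fun x => f (p x)) l.
Proof. induction l as [|a l IH]; simpl; [|rewrite IH]; lra. Qed.

Lemma avg_sumL {S T : Type} (k : S -> T -> R) (l : list T) (l' : list S) : l <> nil ->
  avg l (fun x => sumL (fun y => k y x) l') = sumL (fun y => avg l (k y)) l'.
Proof.
intros nl. induction l' as [|a l' IH]; simpl; [apply avg_const, nl|]. rewrite avg_plus, IH. reflexivity.
Qed.

Lemma avg_exchange {S T : Type} (k : T -> S -> R) (l : list T) (l' : list S) :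
  avg l (fun x => avg l' (k x)) = avg l' (fun y => avg l (fun x => k x y)).
Proof.
unfold avg at 2 3. unfold Rdiv.
transitivity (avg l (fun x => / INR (length l') * sumL (k x) l')).
{ apply avg_ext. intros. ring. }
rewrite avg_scal. unfold avg, Rdiv. rewrite sumL_exchange.
rewrite (sumL_ext (fun y => sumL (fun x => k x y) l * / INR (length l))
                  (fun y => / INR (length l) * sumL (fun x => k x y) l)).
2: intros; ring.
rewrite sumL_scal. ring.
Qed.


(** * Folner averages *)

Section GroupLemmas.
Variable G : Group.
Local Notation "x * y" := (gmul G x y).
Local Notation "x ^-1" := (ginv G x) (at level 3, format "x ^-1").
Local Notation "1" := (gone G).

Lemma gmulKl (x y : G) : x^-1 * (x * y) = y.
Proof. rewrite gmulA, gmulVl, gmul1l. reflexivity. Qed.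

Lemma gmulVr (x : G) : x * x^-1 = 1.
Proof.
transitivity ((x^-1^-1 * x^-1) * (x * x^-1)).
- rewrite gmulVl, gmul1l. reflexivity.
- rewrite <- gmulA, (gmulKl x). apply gmulVl.
Qed.

Lemma gmulKVl (x y : G) : x * (x^-1 * y) = y.
Proof. rewrite gmulA, gmulVr, gmul1l. reflexivity. Qed.

Lemma gmul_cancel (x y z : G) : x * y = x * z -> y = z.
Proof. intros H. rewrite <- (gmulKl x y), H, gmulKl. reflexivity. Qed.

Lemma gmul1r (x : G) : x * 1 = x.
Proof. apply (gmul_cancel x^-1). rewrite gmulKl, gmulVl. reflexivity. Qed.

Lemma ginvK (x : G) : x^-1^-1 = x.
Proof. apply (gmul_cancel x^-1). rewrite gmulVr, gmulVl. reflexivity. Qed.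

Lemma ginvM (x y : G) : (x * y)^-1 = y^-1 * x^-1.
Proof.
apply (gmul_cancel (x * y)). rewrite gmulVr, <- gmulA, gmulKVl, gmulVr. reflexivity.
Qed.

Lemma ginv1 : 1^-1 = 1.
Proof. rewrite <- (gmul1l G 1^-1). apply gmulVr. Qed.

End GroupLemmas.

Lemma sumL_filter {T : Type} (f : T -> R) (b : T -> bool) l :
  sumL f (filter b l) = sumL (fun x => if b x then f x else 0) l.
Proof.
induction l as [|a l IH]; simpl; [reflexivity|].
destruct (b a); simpl; rewrite IH; lra.
Qed.

(** The translates [h g] that stay in [l] are distinct, so they contribute at most the sum over [l];
    each of the others contributes at most [B]. *)
Lemma shift_sum_le (G : Group) (l : list G) (phi : G -> R) B h :
  NoDup l -> (forall g, 0 <= phi g <= B) ->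
  sumL (fun g => phi (gmul G h g)) l <=
  sumL phi l + B * INR (countP (fun g => ~ In (gmul G h g) l) l).
Proof.
intros nd Hphi. rewrite <- sumL_ind_countP, <- sumL_scal.
set (b := fun x : G => if excluded_middle_informative (In x l) then true else false).
apply Rle_trans with (sumL phi (filter b (map (gmul G h) l))
   + sumL (fun x => B * ind (~ In (gmul G h x) l)) l).
- rewrite sumL_filter, sumL_map, <- sumL_plus. apply sumL_le. intros g _. unfold b, ind.
  generalize (Hphi (gmul G h g)).
  destruct (excluded_middle_informative (In (gmul G h g) l));
  destruct (excluded_middle_informative (~ In (gmul G h g) l)); try tauto; lra.
- apply Rplus_le_compat_r. apply sumL_incl.
  + intros; apply Hphi.
  + apply NoDup_filter. apply Injective_map_NoDup; [|exact nd].
    intros x y. apply gmul_cancel.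
  + intros x Hx. apply filter_In in Hx. destruct Hx as [_ Hx]. unfold b in Hx.
    destruct (excluded_middle_informative (In x l)); [assumption|discriminate].
Qed.

Lemma shift_avg_le (G : Group) (l : list G) (phi : G -> R) B h :
  NoDup l -> l <> nil -> (forall g, 0 <= phi g <= B) ->
  Rabs (avg l (fun g => phi (gmul G h g)) - avg l phi)
  <= B * (INR (sym_diff_card G h l) / INR (length l)).
Proof.
intros nd nl Hphi.
assert (B0 : 0 <= B) by (generalize (Hphi (gone G)); lra).
assert (H1 := shift_sum_le G l phi B h nd Hphi).
(* The reverse inequality is the same bound for the inverse of [h] and the translated function. *)
assert (H2 := shift_sum_le G l (fun g => phi (gmul G h g)) B (ginv G h) nd (fun g => Hphi _)).
simpl in H2.
rewrite (sumL_ext (fun g => phi (gmul G h (gmul G (ginv G h) g))) phi) in H2.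
2: intros; rewrite gmulKVl; reflexivity.
unfold sym_diff_card. rewrite plus_INR.
assert (p1 := pos_INR (countP (fun g => ~ In (gmul G h g) l) l)).
assert (p2 := pos_INR (countP (fun g => ~ In (gmul G (ginv G h) g) l) l)).
assert (pl := Rinv_0_lt_compat _ (INR_length_pos l nl)).
unfold avg, Rdiv.
rewrite <- Rmult_minus_distr_r, Rabs_mult, (Rabs_pos_eq (/ _)), <- Rmult_assoc by lra.
apply Rmult_le_compat_r; [lra|].
assert (q1 := Rmult_le_pos _ _ B0 p1). assert (q2 := Rmult_le_pos _ _ B0 p2).
rewrite Rmult_plus_distr_l. apply Rabs_le. lra.
Qed.

Section Folner.
Variables (G : Group) (F : nat -> list G).
Hypothesis HF : Folner G F.

Lemma Folner_nonempty n : F n <> nil.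
Proof. apply HF. Qed.

(** The threshold [N] is chosen before [phi]: this uniformity later allows functions that depend on
    points of [X]. *)
Lemma Folner_avg_shift (hs : list G) B e : 0 < e ->
  exists N, forall n, (N <= n)%nat -> forall h, In h hs ->
  forall phi, (forall g, 0 <= phi g <= B) ->
  Rabs (avg (F n) (fun g => phi (gmul G h g)) - avg (F n) phi) < e.
Proof.
intros He. destruct (Rlt_le_dec B 0) as [HB|HB].
{ exists 0%nat. intros n _ h _ phi H. generalize (H (gone G)). lra. }
induction hs as [|h0 hs [N IH]].
- exists 0%nat. simpl. tauto.
- destruct HF as [Hnd Hcv].
  (* The [+ 1] covers the case [B = 0]. *)
  assert (He' : e / (B + 1) > 0) by (apply Rdiv_lt_0_compat; lra).
  destruct (Hcv h0 _ He') as [M HM].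
  exists (max N M). intros n Hn h [<-|Hh] phi Hphi; [|apply IH; auto; lia].
  eapply Rle_lt_trans; [apply (shift_avg_le G _ phi B); try apply Hnd; assumption|].
  assert (HMn := HM n ltac:(lia)). unfold R_dist in HMn. rewrite Rminus_0_r in HMn.
  apply Rabs_def2 in HMn. destruct HMn as [HMn _].
  apply Rle_lt_trans with (B * (e / (B + 1))).
  + apply Rmult_le_compat_l; lra.
  + assert (e / (B + 1) * (B + 1) = e) by (field; lra). lra.
Qed.

End Folner.

(** * Invariant means *)

(** Finitely additive and defined on all subsets, so that no measurability question arises for sets
    built from orbits. *)
Record invariant_mean (G : Group) (Z : Type) (actZ : G -> Z -> Z) (L : (Z -> Prop) -> R) : Prop := {
  act_one : forall z, actZ (gone G) z = z;
  act_mul : forall g h z, actZ (gmul G g h) z = actZ g (actZ h z);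
  mean_range : forall A, 0 <= L A <= 1;
  mean_mono : forall A B : Z -> Prop, (forall z, A z -> B z) -> L A <= L B;
  mean_add : forall A B : Z -> Prop, (forall z, A z -> B z -> False) ->
    L (fun z => A z \/ B z) = L A + L B;
  mean_inv : forall g A, L (fun z => A (actZ g z)) = L A
}.

(** Split the union into [A] and the rest of [B], and [B] along [A]. This yields the triangle
    inequality for the pseudometric of [eqcl_transfer]. *)
Lemma mean_strong_subadd G Z actZ L (HL : invariant_mean G Z actZ L) (A B C : Z -> Prop) :
  (forall z, C z -> A z /\ B z) -> L (fun z => A z \/ B z) + L C <= L A + L B.
Proof.
intros HC.
apply Rle_trans with (L (fun z => A z \/ (B z /\ ~ A z)) + L (fun z => A z /\ B z)).
- apply Rplus_le_compat; apply (mean_mono _ _ _ _ HL); auto.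
  intros z [?|?]; [tauto|]. destruct (classic (A z)); tauto.
- rewrite (mean_add _ _ _ _ HL) by tauto.
  rewrite Rplus_assoc. apply Rplus_le_compat_l.
  rewrite <- (mean_add _ _ _ _ HL) by tauto.
  apply (mean_mono _ _ _ _ HL). tauto.
Qed.

(** The mean of a set is the generalized limit of the Folner averages of the means of its slices.
    Invariance of [L] handles the coordinate in [Z], the Folner property the one in [G]. The
    positivity clause allows return conditions to be added one at a time. *)
Lemma product_mean (G : Group) (F : nat -> list G) Z actZ L (HF : Folner G F)
  (HL : invariant_mean G Z actZ L) :
  exists L' : (Z * G -> Prop) -> R,
  invariant_mean G (Z * G) (fun g p => (actZ g (fst p), gmul G g (snd p))) L' /\
  forall (S : Z -> Prop) (Q : G -> Prop) c, 0 < L S -> 0 < c ->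
   (exists N, forall n, (N <= n)%nat -> c <= avg (F n) (fun g => ind (Q g))) ->
   0 < L' (fun p => S (fst p) /\ Q (snd p)).
Proof.
destruct generalized_limit_exists as [lim [lim_le [lim_add [lim_const lim_eq]]]].
set (a := fun (S : Z * G -> Prop) n => avg (F n) (fun g => L (fun z => S (z, g)))).
assert (ne := Folner_nonempty G F HF).
assert (ra : forall S n, 0 <= a S n <= 1).
{ intros S n. apply avg_range; [apply ne|]. intros g. apply (mean_range _ _ _ _ HL). }
assert (ba : forall S, bounded_seq (a S)).
{ intros S. exists 1. intros n. generalize (ra S n). intros. rewrite Rabs_pos_eq; lra. }
assert (bc : forall c, bounded_seq (fun _ => c)) by (intros c; exists (Rabs c); intros; lra).
exists (fun S => lim (a S)). split; [split|].
- intros [z g]. simpl. rewrite (act_one _ _ _ _ HL), gmul1l. reflexivity.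
- intros g h [z k]. simpl. rewrite (act_mul _ _ _ _ HL), gmulA. reflexivity.
- intros A. rewrite <- (lim_const 0), <- (lim_const 1) at 1.
  split; apply lim_le; auto; exists 0%nat; intros; apply ra.
- intros A B AB. apply lim_le; auto. exists 0%nat. intros n _. apply avg_le; [apply ne|].
  intros g _. apply (mean_mono _ _ _ _ HL). auto.
- intros A B AB. rewrite <- lim_add; auto. f_equal. apply functional_extensionality.
  intros n. unfold a. rewrite <- avg_plus. apply avg_ext. intros g _.
  apply (mean_add _ _ _ _ HL). intros z. apply AB.
- intros h A. apply lim_eq; auto. intros e He.
  destruct (Folner_avg_shift G F HF (h :: nil) 1 e He) as [N HN].
  exists N. intros n Hn. unfold R_dist. rewrite Rminus_0_r.
  specialize (HN n Hn h (or_introl eq_refl) (fun g => L (fun z => A (z, g)))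
    (fun g => mean_range _ _ _ _ HL _)).
  unfold a. simpl in *.
  rewrite (avg_ext _ _ (fun g => L (fun z => A (z, gmul G h g)))).
  + exact HN.
  + intros g _. apply (mean_inv _ _ _ _ HL h (fun z => A (z, gmul G h g))).
- intros S Q c HS Hc [N HN].
  apply Rlt_le_trans with (L S * c); [apply Rmult_lt_0_compat; assumption|].
  rewrite <- (lim_const (L S * c)). apply lim_le; auto. exists N. intros n Hn.
  apply Rle_trans with (L S * avg (F n) (fun g => ind (Q g))).
  + apply Rmult_le_compat_l; [lra|auto].
  + rewrite <- avg_scal. apply avg_le; [apply ne|]. intros g _. simpl.
    destruct (classic (Q g)) as [q|q].
    * rewrite ind_true by exact q. rewrite Rmult_1_r. apply (mean_mono _ _ _ _ HL). auto.
    * rewrite ind_false by exact q. rewrite Rmult_0_r. apply (mean_range _ _ _ _ HL).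
Qed.

Lemma unit_mean (G : Group) : invariant_mean G unit (fun _ z => z) (fun A => ind (A tt)).
Proof.
split; auto.
- intros A. apply ind_range.
- intros A B AB. apply ind_le. auto.
- intros A B AB. unfold ind.
  destruct (excluded_middle_informative (A tt)); destruct (excluded_middle_informative (B tt));
  destruct (excluded_middle_informative (A tt \/ B tt)); try lra; try tauto.
  destruct (AB tt); assumption.
Qed.

Lemma inf_exists (f : R -> R) : (forall e, 0 < e -> 0 <= f e) -> exists w,
  (forall e, 0 < e -> w <= f e) /\ (forall a, w < a -> exists e, 0 < e /\ f e < a).
Proof.
intros Hf.
destruct (completeness (fun y => exists e, 0 < e /\ y = - f e)) as [m [ub lub]].
- exists 0. intros y [e [He ->]]. generalize (Hf e He). lra.
- exists (- f 1). exists 1. split; [lra|reflexivity].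
- exists (- m). split.
  + intros e He. generalize (ub (- f e) (ex_intro _ e (conj He eq_refl))). lra.
  + intros a Ha. apply NNPP. intros H. assert (m <= - a); [|lra].
    apply lub. intros y [e [He ->]]. apply Ropp_le_contravar, Rnot_lt_le.
    intros Hlt. apply H. exists e. auto.
Qed.

(** * Invariant pseudometrics and McMahon's argument *)

Section MinimalSystem.
Variables (G : Group) (X : MetricSpace) (act : G -> X -> X) (F : nat -> list G).
Hypothesis Htds : tds G X act.
Hypothesis Hmin : minimal_system G X (mopen X) act.
Hypothesis HF : Folner G F.

Local Notation d := (mdist X).
Local Notation "x ^-1" := (ginv G x) (at level 3, format "x ^-1").

Lemma mdist_refl x : d x x = 0.
Proof. apply mdist_eq0. reflexivity. Qed.

Lemma acts_one x : act (gone G) x = x.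
Proof. apply Htds. Qed.

Lemma acts_mul g h x : act (gmul G g h) x = act g (act h x).
Proof. apply Htds. Qed.

Lemma actK g x : act g^-1 (act g x) = x.
Proof. rewrite <- acts_mul, gmulVl, acts_one. reflexivity. Qed.

Lemma actKV g x : act g (act g^-1 x) = x.
Proof. rewrite <- acts_mul, gmulVr, acts_one. reflexivity. Qed.

Lemma act_continuous g x e : 0 < e -> exists del, 0 < del /\
  forall y, d x y < del -> d (act g x) (act g y) < e.
Proof. intros He. destruct Htds as [_ [_ [_ H]]]. destruct (H g x e He) as [del [Hd Hy]]. exists del. auto. Qed.

Lemma point_exists : exists x : X, True.
Proof. destruct Hmin as [_ [_ [[x _] _]]]. exists x. exact I. Qed.

Lemma mopen_act g U : mopen X U -> mopen X (fun x => U (act g x)).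
Proof.
intros HU x Ux. destruct (HU _ Ux) as [r [Hr Hy]].
destruct (act_continuous g x r Hr) as [del [Hd Hc]].
exists del. split; [assumption|]. intros y Hxy. apply Hy, Hc, Hxy.
Qed.

Lemma mopen_and U V : mopen X U -> mopen X V -> mopen X (fun x => U x /\ V x).
Proof.
intros HU HV x [Ux Vx]. destruct (HU _ Ux) as [r [Hr Hy]]. destruct (HV _ Vx) as [s [Hs Hz]].
exists (Rmin r s). split; [apply Rmin_glb_lt; assumption|].
intros y Hxy. split; [apply Hy|apply Hz]; eapply Rlt_le_trans; try exact Hxy;
[apply Rmin_l|apply Rmin_r].
Qed.

(** * Minimality, return times and simultaneous recurrence *)

Lemma minimal_dichotomy (A : X -> Prop) :
  mopen X (fun x => ~ A x) -> (forall g x, A x -> A (act g x)) -> (exists x, A x) -> forall x, A x.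
Proof.
intros HA Hi He x. destruct Hmin as [_ [_ [_ H]]]. apply (H A); auto.
Qed.

(** The points whose orbit misses [U] form a closed invariant set, empty by minimality since [U] is
    not; compactness then makes the cover finite. *)
Lemma translates_cover U : mopen X U -> (exists x, U x) ->
  exists hs : list G, forall x, exists h, In h hs /\ U (act h x).
Proof.
intros HU [u Uu]. destruct Htds as [Hc _].
apply (Hc G (fun h x => U (act h x))).
- intros h. apply mopen_act, HU.
- intros x. apply NNPP. intros Hx.
  assert (H : forall y h, ~ U (act h y)).
  { apply (minimal_dichotomy (fun y => forall h, ~ U (act h y))).
    - intros y Hy. assert (Hh : exists h, U (act h y)).
      { apply NNPP. intros Hk. apply Hy. intros h Uh. apply Hk. exists h. exact Uh. }
      destruct Hh as [h Hh].
      destruct (mopen_act h U HU y Hh) as [r [Hr Hz]].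
      exists r. split; [assumption|]. intros z Hyz Hn. apply (Hn h), Hz, Hyz.
    - intros g y Hy h. rewrite <- acts_mul. apply Hy.
    - exists x. intros h Hh. apply Hx. exists h. exact Hh. }
  apply (H u (gone G)). rewrite acts_one. exact Uu.
Qed.

(** Finitely many translates of [U] cover [X], so the frequencies of their visits add up to at least
    1, while the Folner property makes each of them close to that of [U]. *)
Lemma positive_density U z : mopen X U -> (exists x, U x) ->
  exists c, 0 < c /\ exists N, forall n, (N <= n)%nat -> c <= avg (F n) (fun g => ind (U (act g z))).
Proof.
intros HU HUe. destruct (translates_cover U HU HUe) as [hs Hhs].
assert (Hl : 0 < INR (length hs)).
{ apply INR_length_pos. destruct (Hhs z) as [h [Hh _]]. intros E. rewrite E in Hh. exact Hh. }
(* With [l] translates, [l (D + c) >= 1 = 2 c l] gives [D >= c]. *)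
set (c := / (2 * INR (length hs))).
assert (Hc : 0 < c) by (apply Rinv_0_lt_compat; lra).
exists c. split; [assumption|].
destruct (Folner_avg_shift G F HF hs 1 c Hc) as [N HN].
exists N. intros n Hn.
set (D := avg (F n) (fun g => ind (U (act g z)))).
assert (H1 : 1 <= sumL (fun _ => D + c) hs).
{ apply Rle_trans with (sumL (fun h => avg (F n) (fun g => ind (U (act h (act g z))))) hs).
  - rewrite <- avg_sumL by apply (Folner_nonempty G F HF).
    rewrite <- (avg_const (F n) (Folner_nonempty G F HF n) 1).
    apply avg_le; [apply (Folner_nonempty G F HF)|]. intros g _.
    destruct (Hhs (act g z)) as [h [Hh Uh]].
    rewrite <- (ind_true _ Uh).
    apply (sumL_mem (fun h => ind (U (act h (act g z))))); [|assumption].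
    intros; apply ind_range.
  - apply sumL_le. intros h Hh.
    specialize (HN n Hn h Hh (fun g => ind (U (act g z))) (fun g => ind_range _)). simpl in HN.
    rewrite (avg_ext _ _ (fun g => ind (U (act h (act g z))))) in HN.
    2: intros; rewrite acts_mul; reflexivity.
    apply Rabs_def2 in HN. fold D in HN. lra. }
rewrite sumL_const in H1.
assert (H2 : 2 * c * INR (length hs) = 1) by (unfold c; field; lra).
apply Rnot_lt_le. intros H3.
assert ((D + c) * INR (length hs) < 2 * c * INR (length hs)); [|lra].
apply Rmult_lt_compat_r; lra.
Qed.

(** [Z] is a power of [G] and [S] consists of the tuples [k] with [k_i z0] in [E i]. If [S] contains
    both [k] and [g k], then [k_i z0] is a point of [E i] that [g] returns to [E i], for all [i] at
    once. *)
Lemma recurrence_mean n (E : nat -> X -> Prop) :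
  (forall i, (i < n)%nat -> mopen X (E i) /\ exists x, E i x) ->
  exists Z actZ L (S : Z -> Prop), invariant_mean G Z actZ L /\ 0 < L S /\
    forall g z, S z -> S (actZ g z) -> forall i, (i < n)%nat -> exists x, E i x /\ E i (act g x).
Proof.
destruct point_exists as [z0 _].
induction n as [|n IH]; intros HE.
- exists unit, (fun _ z => z), (fun A => ind (A tt)), (fun _ => True).
  split; [apply unit_mean|]. split; [rewrite ind_true by exact I; lra|]. intros; lia.
- destruct IH as [Z [actZ [L [S [HL [HS Hret]]]]]].
  { intros i Hi. apply HE. lia. }
  destruct (product_mean G F Z actZ L HF HL) as [L' [HL' Hpos]].
  destruct (HE n (Nat.lt_succ_diag_r n)) as [HEo HEn].
  destruct (positive_density (E n) z0 HEo HEn) as [c [Hc HN]].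
  exists (Z * G)%type, (fun g p => (actZ g (fst p), gmul G g (snd p))), L',
    (fun p => S (fst p) /\ E n (act (snd p) z0)).
  split; [assumption|]. split.
  + apply (Hpos S (fun g => E n (act g z0)) c); assumption.
  + intros g [z k] [Sz Ek] [Sgz Egk] i Hi. simpl in *.
    destruct (Nat.eq_dec i n) as [->|ne].
    * exists (act k z0). rewrite <- acts_mul. auto.
    * apply (Hret g z); auto; lia.
Qed.

(** * Continuous invariant pseudometrics and transfer of a single set *)

Definition invariant_pseudometric (r : X -> X -> R) : Prop :=
  (forall x, r x x = 0) /\ (forall x y, r x y = r y x) /\
  (forall x y z, r x z <= r x y + r y z) /\
  (forall g x y, r (act g x) (act g y) = r x y) /\
  (forall x e, 0 < e -> exists del, 0 < del /\ forall y, d x y < del -> r x y < e).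

(* Closure for the topology lifted from the maximal equicontinuous factor. *)
Definition eqcl (D : X -> Prop) (x : X) : Prop :=
  forall r, invariant_pseudometric r -> forall e, 0 < e -> exists y, D y /\ r x y < e.

(* McMahon's argument: [w x] is the mean of the fibre over [x] of the closed invariant set
   generated by [E1 x S]; it is upper semicontinuous and invariant, hence constant, so
   [r x y = mean (fibre x U fibre y) - w] is a continuous invariant pseudometric. *)
Lemma eqcl_transfer Z actZ L (S : Z -> Prop) (E D : X -> Prop) e :
  invariant_mean G Z actZ L -> 0 < L S -> E e -> eqcl D e -> mopen X D ->
  exists g, (exists x, E x /\ D (act g x)) /\ exists z, S z /\ S (actZ g z).
Proof.
intros HL HS Ee Dcl Dop.
assert (mono := mean_mono _ _ _ _ HL).
(* The fibre, over the [eps]-ball around [x], of the invariant set generated by [E x S]. *)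
set (N := fun (x : X) (eps : R) (z : Z) =>
  exists g x', E x' /\ d x (act g x') < eps /\ S (actZ g^-1 z)).
assert (Nmono : forall x y e1 e2, d x y + e2 <= e1 -> forall z, N y e2 z -> N x e1 z).
{ intros x y e1 e2 H z [g [x' [H1 [H2 H3]]]]. exists g, x'. split; [assumption|]. split; [|assumption].
  generalize (mdist_tri X x y (act g x')). lra. }
assert (Nmono0 : forall x e1 e2, e2 <= e1 -> forall z, N x e2 z -> N x e1 z).
{ intros x e1 e2 H. apply Nmono. rewrite mdist_refl. lra. }
assert (Nact : forall h x eps, 0 < eps -> exists del, 0 < del /\
  forall z, N x del (actZ h^-1 z) -> N (act h x) eps z).
{ intros h x eps He. destruct (act_continuous h x eps He) as [del [Hd Hc]].
  exists del. split; [assumption|]. intros z [g [x' [H1 [H2 H3]]]].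
  exists (gmul G h g), x'. split; [assumption|]. split.
  - rewrite acts_mul. apply Hc, H2.
  - rewrite ginvM, (act_mul _ _ _ _ HL). exact H3. }
set (N2 := fun x y eps z => N x eps z \/ N y eps z).
(* [w x y] is the infimum over [eps] of the mean of the union of the thickened fibres. Taking an
   infimum replaces the closure and gives upper semicontinuity. *)
assert (Hw : exists w : X -> X -> R, forall x y,
  (forall eps, 0 < eps -> w x y <= L (N2 x y eps)) /\
  (forall a, w x y < a -> exists eps, 0 < eps /\ L (N2 x y eps) < a)).
{ assert (H : forall p : X * X, exists w,
    (forall eps, 0 < eps -> w <= L (N2 (fst p) (snd p) eps)) /\
    (forall a, w < a -> exists eps, 0 < eps /\ L (N2 (fst p) (snd p) eps) < a)).
  { intros p. apply (inf_exists (fun eps => L (N2 (fst p) (snd p) eps))).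
    intros; apply (mean_range _ _ _ _ HL). }
  exists (fun x y => proj1_sig (constructive_indefinite_description _ (H (x, y)))).
  intros x y. exact (proj2_sig (constructive_indefinite_description _ (H (x, y)))). }
destruct Hw as [w Hw].
assert (wlow : forall x y eps, 0 < eps -> w x y <= L (N2 x y eps)) by apply Hw.
assert (wupp : forall x y a, w x y < a -> exists eps, 0 < eps /\ L (N2 x y eps) < a) by apply Hw.
clear Hw.
assert (wle : forall x y u v,
  (forall eps, 0 < eps -> exists del, 0 < del /\ L (N2 x y del) <= L (N2 u v eps)) -> w x y <= w u v).
{ intros x y u v H. apply Rnot_lt_le. intros Hlt. destruct (wupp _ _ _ Hlt) as [eps [He Hl]].
  destruct (H eps He) as [del [Hd Hl']]. generalize (wlow x y del Hd). lra. }
assert (wsym : forall x y, w x y <= w y x).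
{ intros x y. apply wle. intros eps He. exists eps. split; [assumption|].
  apply mono. unfold N2. tauto. }
assert (winvle : forall h x y, w x y <= w (act h x) (act h y)).
{ intros h x y. apply wle. intros eps He.
  destruct (Nact h x eps He) as [d1 [Hd1 H1]]. destruct (Nact h y eps He) as [d2 [Hd2 H2]].
  exists (Rmin d1 d2). split; [apply Rmin_glb_lt; assumption|].
  rewrite <- (mean_inv _ _ _ _ HL h^-1 (N2 x y (Rmin d1 d2))).
  apply mono. intros z [Hz|Hz]; [left; apply H1|right; apply H2]; eapply Nmono0; try exact Hz.
  apply Rmin_l. apply Rmin_r. }
assert (winv : forall h x y, w (act h x) (act h y) = w x y).
{ intros h x y. apply Rle_antisym; [|apply winvle].
  rewrite <- (actK h x) at 2. rewrite <- (actK h y) at 2. apply winvle. }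
assert (wusc : forall x a, w x x < a -> exists eps, 0 < eps /\ forall y, d x y < eps -> w x y < a).
{ intros x a Ha. destruct (wupp _ _ _ Ha) as [eps [He Hl]].
  exists (eps / 2). split; [lra|]. intros y Hy.
  eapply Rle_lt_trans; [apply (wlow x y (eps / 2)); lra|].
  eapply Rle_lt_trans; [|exact Hl]. apply mono. intros z [Hz|Hz]; left; revert Hz.
  - apply Nmono0. lra.
  - apply Nmono. lra. }
assert (wdiag : forall x y, w x x <= w x y).
{ intros x y. apply wle. intros eps He. exists eps. split; [assumption|].
  apply mono. unfold N2. tauto. }
assert (wconst : forall x y, w x x <= w y y).
{ intros x y.
  (* Upper semicontinuity on the diagonal makes this superlevel set closed; it is invariant and
     contains [x]. *)
  apply (minimal_dichotomy (fun y => w x x <= w y y)).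
  - intros u Hu. apply Rnot_le_lt in Hu. destruct (wusc _ _ Hu) as [eps [He H]].
    exists eps. split; [assumption|]. intros v Hv. apply Rlt_not_le.
    apply Rle_lt_trans with (w u v); [|auto].
    eapply Rle_trans; [apply wdiag|apply wsym].
  - intros g u Hu. rewrite winv. exact Hu.
  - exists x. lra. }
set (c := w e e).
assert (wc : forall x, w x x = c) by (intros x; apply Rle_antisym; apply wconst).
set (r := fun x y => w x y - c).
assert (Hr : invariant_pseudometric r).
{ unfold r. split; [|split; [|split; [|split]]].
  - intros x. rewrite wc. lra.
  - intros x y. f_equal. apply Rle_antisym; apply wsym.
  - intros x y z. apply Rnot_lt_le. intros Hlt.
    set (t := (w x z + c - w x y - w y z) / 2).
    destruct (wupp x y (w x y + t)) as [e1 [He1 H1]]; [unfold t; lra|].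
    destruct (wupp y z (w y z + t)) as [e2 [He2 H2]]; [unfold t; lra|].
    set (e3 := Rmin e1 e2).
    assert (He3 : 0 < e3) by (apply Rmin_glb_lt; assumption).
    (* Both unions contain the fibre over [y], whose mean is at least [c]. *)
    assert (H3 := mean_strong_subadd _ _ _ _ HL (N2 x y e3) (N2 y z e3) (N2 y y e3)
      ltac:(unfold N2; tauto)).
    assert (H4 : L (N2 x y e3) <= L (N2 x y e1)).
    { apply mono. intros u [Hu|Hu]; [left|right]; revert Hu; apply Nmono0; apply Rmin_l. }
    assert (H5 : L (N2 y z e3) <= L (N2 y z e2)).
    { apply mono. intros u [Hu|Hu]; [left|right]; revert Hu; apply Nmono0; apply Rmin_r. }
    assert (H6 : L (N2 x z e3) <= L (fun u => N2 x y e3 u \/ N2 y z e3 u)).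
    { apply mono. unfold N2. tauto. }
    generalize (wlow x z e3 He3) (wlow y y e3 He3). rewrite wc. unfold t in *. lra.
  - intros g x y. rewrite winv. reflexivity.
  - intros x eps He. destruct (wusc x (c + eps)) as [del [Hd H]]; [rewrite wc; lra|].
    exists del. split; [assumption|]. intros y Hy. specialize (H y Hy). lra. }
(* As [e] is in [E], the fibre over [e] contains [S]. Its union with the fibre over [y] has mean
   below [c + L S], while the fibre over [y] alone has at least [c]; hence [S] meets the latter. *)
destruct (Dcl r Hr (L S) HS) as [y [Dy Hy]].
destruct (Dop y Dy) as [eps [He HDy]].
destruct (wupp e y (c + L S)) as [e1 [He1 H1]]; [unfold r in Hy; lra|].
set (e2 := Rmin e1 eps).
assert (He2 : 0 < e2) by (apply Rmin_glb_lt; assumption).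
assert (H2 : exists z, S z /\ N y e2 z).
{ apply NNPP. intros Hn.
  assert (Hadd : L (fun z => S z \/ N2 y y e2 z) = L S + L (N2 y y e2)).
  { apply (mean_add _ _ _ _ HL). intros z Sz [Nz|Nz]; apply Hn; exists z; auto. }
  assert (Hle : L (fun z => S z \/ N2 y y e2 z) <= L (N2 e y e1)).
  { apply mono. intros z [Sz|Nz].
    - left. exists (gone G), e. split; [assumption|]. rewrite acts_one, mdist_refl.
      split; [assumption|].
      rewrite ginv1, (act_one _ _ _ _ HL). exact Sz.
    - right. unfold N2 in Nz. assert (Nz' : N y e2 z) by tauto. revert Nz'. apply Nmono0, Rmin_l. }
  generalize (wlow y y e2 He2). rewrite wc. lra. }
destruct H2 as [z [Sz [g [x' [Ex' [Hd' Sg]]]]]].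
exists g. split.
- exists x'. split; [assumption|]. apply HDy. eapply Rlt_le_trans; [exact Hd'|apply Rmin_r].
- exists (actZ g^-1 z). split; [assumption|].
  rewrite <- (act_mul _ _ _ _ HL), gmulVr, (act_one _ _ _ _ HL). exact Sz.
Qed.

(** * Poincare recurrence and simultaneous transfer *)

Hypothesis Hinf : infinite_group G.

(** Since [G] is infinite, each new [g] can avoid the finitely many elements whose quotient with an
    earlier entry lies in [l]. *)
Lemma separated_list l m : exists a : list G, length a = m /\
  ForallOrdPairs (fun g h => ~ In (gmul G h g^-1) l) a.
Proof.
induction m as [|m [a [Hl Ha]]].
- exists nil. split; [reflexivity|constructor].
- destruct (Hinf (flat_map (fun h => map (fun k => gmul G k^-1 h) l) a)) as [g Hg].
  exists (g :: a). split; [simpl; congruence|]. constructor; [|assumption].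
  apply Forall_forall. intros h Hh Hin. apply Hg. apply in_flat_map. exists h. split; [assumption|].
  apply in_map_iff. exists (gmul G h g^-1). split; [|assumption].
  rewrite ginvM, ginvK, <- gmulA, gmulVl, gmul1r. reflexivity.
Qed.

(* Poincare recurrence: more than [1 / L S] translates of [S] cannot be pairwise disjoint. *)
Lemma mean_recurrence Z actZ L (S : Z -> Prop) l :
  invariant_mean G Z actZ L -> 0 < L S ->
  exists g, ~ In g l /\ exists z, S z /\ S (actZ g z).
Proof.
intros HL HS. apply NNPP. intros Hn.
destruct (INR_unbounded (/ L S)) as [m Hm].
destruct (separated_list l m) as [a [Hla Ha]].
assert (H : INR (length a) * L S <= L (fun z => exists g, In g a /\ S (actZ g z))).
{ clear Hla. induction Ha as [|g a Hg Ha IH].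
  - simpl. rewrite Rmult_0_l. apply (mean_range _ _ _ _ HL).
  - simpl length. rewrite S_INR.
    apply Rle_trans with (L (fun z => S (actZ g z) \/ exists h, In h a /\ S (actZ h z))).
    + rewrite (mean_add _ _ _ _ HL), (mean_inv _ _ _ _ HL). lra.
      (* A common point of two translates of [S] would give a return along [h g^-1], which lies
         outside [l]. *)
      intros z Sz [h [Hh Sh]]. apply Hn. exists (gmul G h g^-1). split.
      * rewrite Forall_forall in Hg. exact (Hg h Hh).
      * exists (actZ g z). split; [assumption|].
        rewrite <- (act_mul _ _ _ _ HL), <- gmulA, gmulVl, gmul1r. exact Sh.
    + apply (mean_mono _ _ _ _ HL). intros z [Sz|[h [Hh Sh]]].
      * exists g. simpl. auto.
      * exists h. simpl. auto. }
rewrite Hla in H. assert (Hr := proj2 (mean_range _ _ _ _ HL (fun z => exists g, In g a /\ S (actZ g z)))).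
assert (/ L S * L S = 1) by (field; lra).
assert (/ L S * L S < INR m * L S) by (apply Rmult_lt_compat_r; lra). lra.
Qed.

(** Induction on [k]: one [g] brings a point of [E i] into [D i] for [i < k] and back into [E i] for
    [i >= k]. The next element transfers the [k]-th set while returning all the others to
    themselves, because [eqcl_transfer] also yields a return of [S]. *)
Lemma eqcl_transfer_all n (E D : nat -> X -> Prop) (l : list G) :
  (forall i, (i < n)%nat -> mopen X (E i) /\ mopen X (D i) /\ (exists x, E i x) /\
     forall x, E i x -> eqcl (D i) x) ->
  exists g, ~ In g l /\ forall i, (i < n)%nat -> exists x, E i x /\ D i (act g x).
Proof.
intros H.
assert (Hk : forall k, (k <= n)%nat -> exists g, forall i, (i < n)%nat ->
   exists x, E i x /\ ((i < k)%nat -> D i (act g x)) /\ ((k <= i)%nat -> E i (act g x))).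
{ induction k as [|k IH]; intros Hkn.
  - exists (gone G). intros i Hi. destruct (H i Hi) as [_ [_ [[x Ex] _]]].
    exists x. rewrite acts_one. split; [assumption|]. split; [lia|auto].
  - destruct IH as [g Hg]; [lia|].
    (* The open sets of images under [g] that record what has been achieved; returning to them
       preserves it. *)
    set (E' := fun i y => E i (act g^-1 y) /\ ((i < k)%nat -> D i y) /\ ((k <= i)%nat -> E i y)).
    destruct (recurrence_mean n E') as [Z [actZ [L [S [HL [HS Hret]]]]]].
    { intros i Hi. destruct (H i Hi) as [oE [oD [_ _]]]. split.
      - apply mopen_and; [apply mopen_act, oE|].
        destruct (Nat.lt_ge_cases i k) as [c|c].
        + intros x [Dx _]. destruct (oD x (Dx c)) as [r [Hr Hy]]. exists r. split; [assumption|].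
          intros y Hxy. split; [auto|lia].
        + intros x [_ Ex]. destruct (oE x (Ex c)) as [r [Hr Hy]]. exists r. split; [assumption|].
          intros y Hxy. split; [lia|auto].
      - destruct (Hg i Hi) as [x [Ex [H1 H2]]]. exists (act g x). split; [rewrite actK; assumption|auto]. }
    destruct (Hg k Hkn) as [x [Ex [_ H2]]]. specialize (H2 (le_n k)).
    destruct (H k Hkn) as [_ [oD [_ Hcl]]].
    destruct (eqcl_transfer Z actZ L S (E' k) (D k) (act g x) HL HS) as [h [[y [Ey Dy]] [z [Sz Shz]]]];
      try assumption.
    { split; [rewrite actK; assumption|]. split; [lia|auto]. }
    { apply Hcl. assumption. }
    exists (gmul G h g). intros i Hi.
    destruct (Nat.eq_dec i k) as [->|ne].
    + exists (act g^-1 y). rewrite acts_mul, actKV. split; [apply Ey|]. split; [auto|lia].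
    + destruct (Hret h z Sz Shz i Hi) as [u [Eu Ehu]].
      exists (act g^-1 u). rewrite acts_mul, actKV. split; [apply Eu|].
      split; intros; apply Ehu; lia. }
destruct (Hk n (le_n n)) as [g Hg].
set (E' := fun i y => E i (act g^-1 y) /\ D i y).
destruct (recurrence_mean n E') as [Z [actZ [L [S [HL [HS Hret]]]]]].
{ intros i Hi. destruct (H i Hi) as [oE [oD [_ _]]]. split.
  - apply mopen_and; [apply mopen_act, oE|assumption].
  - destruct (Hg i Hi) as [x [Ex [H1 _]]]. exists (act g x). split; [rewrite actK; assumption|auto]. }
(* A last simultaneous return [h] makes [h g] avoid [l]. *)
destruct (mean_recurrence Z actZ L S (map (fun k => gmul G k g^-1) l) HL HS) as [h [Hl [z [Sz Shz]]]].
exists (gmul G h g). split.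
- intros Hin. apply Hl. apply in_map_iff. exists (gmul G h g). split; [|assumption].
  rewrite <- gmulA, gmulVr, gmul1r. reflexivity.
- intros i Hi. destruct (Hret h z Sz Shz i Hi) as [u [Eu Ehu]].
  exists (act g^-1 u). rewrite acts_mul, actKV. split; [apply Eu|apply Ehu].
Qed.

(** * Balls, closures and interiors in the equicontinuous factor *)

Section Pseudometric.
Variable r : X -> X -> R.
Hypothesis Hr : invariant_pseudometric r.

Lemma ps_refl x : r x x = 0. Proof. apply Hr. Qed.
Lemma ps_sym x y : r x y = r y x. Proof. apply Hr. Qed.
Lemma ps_tri x y z : r x z <= r x y + r y z. Proof. apply Hr. Qed.
Lemma ps_act g x y : r (act g x) (act g y) = r x y. Proof. apply Hr. Qed.
Lemma ps_pos x y : 0 <= r x y.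
Proof. generalize (ps_tri x y x). rewrite ps_refl, (ps_sym y x). lra. Qed.

Lemma ps_ball_open x e : mopen X (fun y => r x y < e).
Proof.
intros y Hy. destruct Hr as [_ [_ [_ [_ Hc]]]].
destruct (Hc y (e - r x y)) as [del [Hd H]]; [lra|].
exists del. split; [assumption|]. intros z Hz. generalize (H z Hz) (ps_tri x y z). lra.
Qed.
End Pseudometric.

Lemma ps_zero : invariant_pseudometric (fun _ _ => 0).
Proof. repeat split; intros; try lra. exists 1. split; intros; lra. Qed.

Lemma ps_sum r1 r2 : invariant_pseudometric r1 -> invariant_pseudometric r2 ->
  invariant_pseudometric (fun x y => r1 x y + r2 x y).
Proof.
intros H1 H2. split; [|split; [|split; [|split]]].
- intros x. rewrite !ps_refl by assumption. lra.
- intros x y. rewrite (ps_sym r1 H1), (ps_sym r2 H2). reflexivity.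
- intros x y z. generalize (ps_tri r1 H1 x y z) (ps_tri r2 H2 x y z). lra.
- intros g x y. rewrite (ps_act r1 H1), (ps_act r2 H2). reflexivity.
- intros x e He. destruct H1 as [_ [_ [_ [_ C1]]]]. destruct H2 as [_ [_ [_ [_ C2]]]].
  destruct (C1 x (e / 2)) as [d1 [Hd1 K1]]; [lra|]. destruct (C2 x (e / 2)) as [d2 [Hd2 K2]]; [lra|].
  exists (Rmin d1 d2). split; [apply Rmin_glb_lt; assumption|]. intros y Hy.
  generalize (K1 y (Rlt_le_trans _ _ _ Hy (Rmin_l _ _))) (K2 y (Rlt_le_trans _ _ _ Hy (Rmin_r _ _))). lra.
Qed.

Lemma eqcl_mono (D D' : X -> Prop) x : (forall y, D y -> D' y) -> eqcl D x -> eqcl D' x.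
Proof. intros H HD r Hr e He. destruct (HD r Hr e He) as [y [Dy Hy]]. exists y. auto. Qed.

Lemma eqcl_complement_open D x : ~ eqcl D x -> exists r e, invariant_pseudometric r /\ 0 < e /\
  forall y, r x y < e -> ~ eqcl D y.
Proof.
intros H. apply NNPP. intros Hn. apply H. intros r Hr e He. apply NNPP. intros Hno.
apply Hn. exists r, (e / 2). split; [assumption|]. split; [lra|].
intros y Hy Hcl. destruct (Hcl r Hr (e / 2)) as [z [Dz Hz]]; [lra|].
apply Hno. exists z. split; [assumption|]. generalize (ps_tri r Hr x y z). lra.
Qed.

(** Finitely many translates of [eqcl U] cover [X], and a finite union of closed sets with empty
    interior contains no ball. The centre [v] can be taken in [U] itself at the cost of half the
    radius. *)
Lemma eqcl_interior U : mopen X U -> (exists x, U x) ->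
  exists r v s, invariant_pseudometric r /\ U v /\ 0 < s /\ forall x, r v x < s -> eqcl U x.
Proof.
intros HU HUe. destruct (translates_cover U HU HUe) as [hs Hhs].
assert (Hcov : forall x, exists h, In h hs /\ eqcl U (act h x)).
{ intros x. destruct (Hhs x) as [h [Hh Uh]]. exists h. split; [assumption|].
  intros r Hr e He. exists (act h x). rewrite (ps_refl r Hr). auto. }
clear Hhs.
assert (H : exists r v s, invariant_pseudometric r /\ 0 < s /\ forall x, r v x < s -> eqcl U x).
{ destruct point_exists as [x0 _].
  (* A finite Baire argument: either the first translate fills the ball, or the ball shrinks to one
     around a missed point, disjoint from that translate. *)
  assert (Hgen : forall hs r v s, invariant_pseudometric r -> 0 < s ->
    (forall x, r v x < s -> exists h, In h hs /\ eqcl U (act h x)) ->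
    exists r v s, invariant_pseudometric r /\ 0 < s /\ forall x, r v x < s -> eqcl U x).
  { clear hs Hcov. induction hs as [|h hs IH]; intros r v s Hr Hs Hc.
    - destruct (Hc v) as [h [[] _]]. rewrite (ps_refl r Hr). assumption.
    - destruct (classic (forall x, r v x < s -> eqcl U (act h x))) as [Hall|Hnot].
      + exists r, (act h v), s. split; [assumption|]. split; [assumption|].
        intros x Hx. rewrite <- (actKV h x). apply Hall.
        rewrite <- (ps_act r Hr h), actKV. assumption.
      + apply not_all_ex_not in Hnot. destruct Hnot as [x Hx]. apply imply_to_and in Hx.
        destruct Hx as [Hx Hncl].
        destruct (eqcl_complement_open U (act h x) Hncl) as [r' [e [Hr' [He Hball]]]].
        apply (IH (fun a b => r a b + r' a b) x (Rmin (s - r v x) e)).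
        * apply ps_sum; assumption.
        * apply Rmin_glb_lt; lra.
        * intros y Hy. assert (H1 := Rlt_le_trans _ _ _ Hy (Rmin_l _ _)).
          assert (H2 := Rlt_le_trans _ _ _ Hy (Rmin_r _ _)).
          assert (p1 := ps_pos r Hr x y). assert (p2 := ps_pos r' Hr' x y).
          destruct (Hc y) as [k [[<-|Hk] Hcl]].
          { generalize (ps_tri r Hr v x y). lra. }
          { exfalso. apply (Hball (act h y)); [|assumption]. rewrite (ps_act r' Hr'). lra. }
          { exists k. auto. } }
  apply (Hgen hs (fun _ _ => 0) x0 1); [apply ps_zero|lra|]. intros; apply Hcov. }
destruct H as [r [v [s [Hr [Hs Hball]]]]].
assert (Hv : eqcl U v) by (apply Hball; rewrite (ps_refl r Hr); assumption).
destruct (Hv r Hr (s / 2)) as [u [Uu Hu]]; [lra|].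
exists r, u, (s / 2). split; [assumption|]. split; [assumption|]. split; [lra|].
intros x Hx. apply Hball. generalize (ps_tri r Hr v u x). lra.
Qed.

(** * Densities in the equicontinuous factor *)

(* Unique ergodicity of the maximal equicontinuous factor, uniformly in the starting points.
   With [k z y = max 0 (eta - r z y)], count the [k]-weighted pairs [(g x, h y)] with [g x] in [A]
   in both orders; invariance makes the [F n]-average of [k z (g x)] nearly independent of [z]. *)
Lemma uniform_density r eta : invariant_pseudometric r -> 0 < eta ->
  exists N, forall n m, (N <= n)%nat -> (N <= m)%nat -> forall x y (A : X -> Prop),
  avg (F n) (fun g => ind (A (act g x))) <=
  avg (F m) (fun g => ind (exists a, A a /\ r a (act g y) < eta)) + eta.
Proof.
intros Hr Heta. destruct point_exists as [z0 _].
assert (ne := Folner_nonempty G F HF).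
assert (Hnet : forall e, 0 < e -> exists hs : list G, forall x, exists h, In h hs /\ r z0 (act h x) < e).
{ intros e He. apply (translates_cover (fun y => r z0 y < e)).
  - apply (ps_ball_open r Hr).
  - exists z0. rewrite (ps_refl r Hr). exact He. }
destruct (Hnet (eta / 2)) as [hs Hhs]; [lra|].
set (l := INR (length hs)).
assert (Hl : 0 < l).
{ apply INR_length_pos. destruct (Hhs z0) as [h [Hh _]]. intros E. rewrite E in Hh. exact Hh. }
(* The first bound yields [q >= eta / (4 l)]; the second makes the total error [4 e] at most [eta]
   times that lower bound. *)
set (e := Rmin (eta / (4 * l)) (eta * eta / (16 * l))).
assert (He : 0 < e).
{ apply Rmin_glb_lt; apply Rdiv_lt_0_compat; try lra. apply Rmult_lt_0_compat; lra. }
assert (e_le1 : e <= eta / (4 * l)) by apply Rmin_l.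
assert (e_le2 : e <= eta * eta / (16 * l)) by apply Rmin_r.
set (k := fun z y => Rmax 0 (eta - r z y)).
assert (k_range : forall z y, 0 <= k z y <= eta).
{ intros z y. unfold k. split; [apply Rmax_l|]. apply Rmax_lub; [lra|]. generalize (ps_pos r Hr z y). lra. }
assert (k_sym : forall z y, k z y = k y z) by (intros; unfold k; rewrite (ps_sym r Hr); reflexivity).
assert (k_act : forall g z y, k (act g z) (act g y) = k z y).
{ intros. unfold k. rewrite (ps_act r Hr). reflexivity. }
assert (k_lip : forall z z' y, k z y <= k z' y + r z' z).
{ intros z z' y. unfold k. generalize (Rmax_l 0 (eta - r z' y)) (Rmax_r 0 (eta - r z' y)).
  intros H1 H2. apply Rmax_lub; generalize (ps_pos r Hr z' z) (ps_tri r Hr z' z y); lra. }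
set (q := fun n x z => avg (F n) (fun g => k z (act g x))).
destruct (Hnet (e / 2)) as [hs' Hhs']; [lra|].
destruct (Folner_avg_shift G F HF hs' eta (e / 2)) as [N HN]; [lra|].
(* Some [h] of a finite list moves [z] close to [z0]; shifting the average by [h] costs [e / 2] and
   the Lipschitz bound another [e / 2]. *)
assert (q_const : forall n, (N <= n)%nat -> forall x z, q n x z0 - e <= q n x z <= q n x z0 + e).
{ intros n Hn x z. destruct (Hhs' z) as [h [Hh Hz]].
  specialize (HN n Hn h Hh (fun g => k (act h z) (act g x)) (fun g => k_range _ _)). simpl in HN.
  rewrite (avg_ext _ _ (fun g => k z (act g x))) in HN.
  2: intros; rewrite acts_mul, k_act; reflexivity.
  fold (q n x z) in HN. fold (q n x (act h z)) in HN. apply Rabs_def2 in HN.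
  assert (H1 : q n x (act h z) <= q n x z0 + e / 2).
  { unfold q. rewrite <- (avg_const (F n) (ne n) (e / 2)). rewrite <- avg_plus.
    apply avg_le; [apply ne|]. intros g _. generalize (k_lip (act h z) z0 (act g x)). lra. }
  assert (H2 : q n x z0 <= q n x (act h z) + e / 2).
  { unfold q. rewrite <- (avg_const (F n) (ne n) (e / 2)). rewrite <- avg_plus.
    apply avg_le; [apply ne|]. intros g _. generalize (k_lip z0 (act h z) (act g x)).
    rewrite (ps_sym r Hr (act h z) z0). lra. }
  lra. }
(* The kernels centred at the translates of [z0] by the inverses of [hs] add up to at least
   [eta / 2] everywhere. *)
assert (q_low : forall n, (N <= n)%nat -> forall x, eta / (4 * l) <= q n x z0).
{ intros n Hn x.
  assert (H1 : eta / 2 <= (q n x z0 + e) * l).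
  { unfold l. rewrite <- sumL_const.
    apply Rle_trans with (sumL (fun h => q n x (act h^-1 z0)) hs).
    - unfold q. rewrite <- (avg_sumL (fun h g => k (act h^-1 z0) (act g x))) by apply ne.
      rewrite <- (avg_const (F n) (ne n) (eta / 2)). apply avg_le; [apply ne|]. intros g _.
      destruct (Hhs (act g x)) as [h [Hh Hz]].
      apply Rle_trans with (k (act h^-1 z0) (act g x)).
      + rewrite <- (k_act h), actKV. unfold k. eapply Rle_trans; [|apply Rmax_r]. lra.
      + apply (sumL_mem (fun h => k (act h^-1 z0) (act g x))); [|assumption]. intros; apply k_range.
    - apply sumL_le. intros h _. apply q_const, Hn. }
  assert (H2 : eta / 2 = 2 * (eta / (4 * l)) * l) by (field; lra).
  apply Rnot_lt_le. intros H3.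
  assert ((q n x z0 + e) * l < 2 * (eta / (4 * l)) * l); [|lra].
  apply Rmult_lt_compat_r; lra. }
exists N. intros n m Hn Hm x y A.
set (B := fun b => exists a, A a /\ r a b < eta).
set (D := avg (F n) (fun g => ind (A (act g x)))).
change (D <= avg (F m) (fun g => ind (B (act g y))) + eta).
set (D' := avg (F m) (fun g => ind (B (act g y)))).
assert (rD : 0 <= D <= 1) by (apply avg_range; [apply ne|]; intros; apply ind_range).
assert (rD' : 0 <= D' <= 1) by (apply avg_range; [apply ne|]; intros; apply ind_range).
set (c := q m y z0). set (c' := q n x z0).
assert (Hcc : c' <= c + 2 * e).
{ assert (H1 : avg (F n) (fun g => q m y (act g x)) <= c + e).
  { apply (avg_range (F n) (ne n) _ (c - e) (c + e)). intros g. apply q_const, Hm. }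
  assert (H2 : c' - e <= avg (F m) (fun h => q n x (act h y))).
  { apply (avg_range (F m) (ne m) _ (c' - e) (c' + e)). intros g. apply q_const, Hn. }
  assert (H3 : avg (F n) (fun g => q m y (act g x)) = avg (F m) (fun h => q n x (act h y))).
  { unfold q. rewrite avg_exchange. apply avg_ext. intros h _. apply avg_ext. intros g _. apply k_sym. }
  lra. }
assert (H1 : D * (c - e) <= avg (F n) (fun g => ind (A (act g x)) * q m y (act g x))).
{ unfold D. rewrite Rmult_comm, <- avg_scal. apply avg_le; [apply ne|]. intros g _.
  rewrite Rmult_comm. apply Rmult_le_compat_l; [apply ind_range|]. apply q_const, Hm. }
assert (H2 : avg (F m) (fun h => ind (B (act h y)) * q n x (act h y)) <= D' * (c' + e)).
{ unfold D'. rewrite Rmult_comm, <- avg_scal. apply avg_le; [apply ne|]. intros g _.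
  rewrite Rmult_comm. apply Rmult_le_compat_r; [apply ind_range|]. apply q_const, Hn. }
(* A pair of nonzero weight with [g x] in [A] has [h y] in [B], by definition of [B]. *)
assert (H3 : avg (F n) (fun g => ind (A (act g x)) * q m y (act g x)) <=
             avg (F m) (fun h => ind (B (act h y)) * q n x (act h y))).
{ rewrite (avg_ext _ _ (fun g => avg (F m) (fun h => ind (A (act g x)) * k (act g x) (act h y)))).
  2: { intros g _. unfold q. rewrite avg_scal. reflexivity. }
  rewrite avg_exchange. apply avg_le; [apply ne|]. intros h _. unfold q. rewrite <- avg_scal.
  apply avg_le; [apply ne|]. intros g _.
  destruct (classic (A (act g x))) as [a|a].
  - destruct (Rlt_le_dec (r (act g x) (act h y)) eta) as [lt|ge].
    + rewrite (ind_true (A _)) by assumption. rewrite ind_true by (exists (act g x); auto).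
      rewrite k_sym. lra.
    + assert (Hk : k (act g x) (act h y) = 0) by (unfold k; apply Rmax_left; lra).
      rewrite (k_sym (act h y)), Hk. lra.
  - rewrite (ind_false (A _)) by assumption. rewrite Rmult_0_l.
    apply Rmult_le_pos; [apply ind_range|apply k_range]. }
assert (H4 : D' * (c' + e) <= D' * (c + 3 * e)) by (apply Rmult_le_compat_l; lra).
assert (H5 : (D - D') * c <= 4 * e).
{ assert (D * e <= 1 * e) by (apply Rmult_le_compat_r; lra).
  assert (D' * e <= 1 * e) by (apply Rmult_le_compat_r; lra).
  replace ((D - D') * c) with (D * (c - e) + D * e - D' * (c + 3 * e) + 3 * (D' * e)) by ring. lra. }
assert (Hc := q_low m Hm y). fold c in Hc.
assert (Hp : 0 < eta / (4 * l)) by (apply Rdiv_lt_0_compat; lra).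
apply Rnot_lt_le. intros Hlt.
assert (eta * c < (D - D') * c) by (apply Rmult_lt_compat_r; lra).
assert (eta * (eta / (4 * l)) <= eta * c) by (apply Rmult_le_compat_l; lra).
assert (4 * (eta * eta / (16 * l)) = eta * (eta / (4 * l))) by (field; lra).
lra.
Qed.

(** * Visits to the intersection of the images of the [U k], and their stability *)

Section Independence.
Variables (K : nat) (U : nat -> X -> Prop).
Hypothesis U_open : forall k, (k < K)%nat -> mopen X (U k).

(** As [r] grows and [e] shrinks, these sets decrease to the intersection of the sets [eqcl (U k)],
    the preimage of [A]. *)
Definition near (r : X -> X -> R) (e : R) (x : X) : Prop :=
  forall k, (k < K)%nat -> exists u, U k u /\ r x u < e.

Lemma near_mono (r r' : X -> X -> R) e e' x y a :
  invariant_pseudometric r -> (forall x y, r x y <= r' x y) -> r x y <= a -> e' + a <= e ->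
  near r' e' x -> near r e y.
Proof.
intros Hr Hle Hxy Hs Hn k Hk. destruct (Hn k Hk) as [u [Uu Hu]]. exists u. split; [assumption|].
generalize (ps_tri r Hr y x u) (Hle x u). rewrite (ps_sym r Hr y x). lra.
Qed.

(** Simultaneous visits of all [p s] to [A] with positive density, expressed through its
    neighbourhoods with one [c] for all of them. The Folner sets are asymptotically invariant under
    left translation only, so the extra right factor [h] lets the condition survive a common
    translation of the points. *)
Definition good (m : nat) (p : nat -> X) : Prop :=
  exists c, 0 < c /\ forall r, invariant_pseudometric r -> forall e, 0 < e -> forall N,
  exists n, (N <= n)%nat /\ exists h,
  c <= avg (F n) (fun g => ind (forall s, (s < m)%nat -> near r e (act g (act h (p s))))).

Lemma good_act m p g : good m (fun s => act g (p s)) -> good m p.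
Proof.
intros [c [Hc H]]. exists c. split; [assumption|]. intros r Hr e He N.
destruct (H r Hr e He N) as [n [Hn [h Hh]]]. exists n. split; [assumption|].
exists (gmul G h g). eapply Rle_trans; [exact Hh|]. apply avg_le; [apply (Folner_nonempty G F HF)|].
intros k _. apply ind_le. intros Hs s Hm. rewrite acts_mul. apply Hs, Hm.
Qed.

(** The infimum of the uniform upper densities of the neighbourhoods plays the role of the measure
    of [A]. A nearly optimal neighbourhood exceeds any finer one by little: the finer one has
    density near the infimum somewhere, hence everywhere by [uniform_density]. *)
Lemma near_shell t : 0 < t -> exists r e, invariant_pseudometric r /\ 0 < e /\
  forall r' e', invariant_pseudometric r' -> 0 < e' -> (forall x y, r x y <= r' x y) -> e' <= e ->
  exists N, forall n, (N <= n)%nat -> forall x,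
  avg (F n) (fun g => ind (near r e (act g x) /\ ~ near r' e' (act g x))) <= t.
Proof.
intros Ht. assert (ne := Folner_nonempty G F HF).
set (P := fun a => exists r e N, invariant_pseudometric r /\ 0 < e /\ forall n, (N <= n)%nat ->
  forall x, avg (F n) (fun g => ind (near r e (act g x))) <= a).
(* Completeness is applied to negatives, so [- b] is the infimum. *)
destruct (completeness (fun b => P (- b))) as [b [ub lub]].
{ exists 0. intros b [r [e [N [_ [_ H]]]]]. destruct point_exists as [x0 _].
  specialize (H N (le_n N) x0).
  assert (H0 : 0 <= avg (F N) (fun g => ind (near r e (act g x0)))).
  { apply (avg_range (F N) (ne N) _ 0 1). intros; apply ind_range. }
  lra. }
{ exists (-1). exists (fun _ _ => 0), 1, 0%nat. split; [apply ps_zero|]. split; [lra|].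
  intros n _ x. replace (- -1) with 1 by ring. apply (avg_range (F n) (ne n) _ 0 1). intros; apply ind_range. }
assert (H1 : exists a, a < - b + t / 4 /\ P a).
{ apply NNPP. intros Hn. assert (b <= b - t / 4); [|lra]. apply lub. intros b' Hb'.
  apply Rnot_lt_le. intros Hlt. apply Hn. exists (- b'). split; [lra|assumption]. }
destruct H1 as [a [Ha [r [e [N0 [Hr [He HN0]]]]]]].
exists r, e. split; [assumption|]. split; [assumption|].
intros r' e' Hr' He' Hle Hee.
(* [e' / 2] keeps the [eta]-neighbourhood inside [near r' e']; [t / 4] bounds the loss of
   density. *)
set (eta := Rmin (e' / 2) (t / 4)).
assert (Heta : 0 < eta) by (apply Rmin_glb_lt; lra).
assert (Heta1 : eta <= e' / 2) by apply Rmin_l. assert (Heta2 : eta <= t / 4) by apply Rmin_r.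
destruct (uniform_density r' eta Hr' Heta) as [N1 HN1].
assert (H2 : exists n1 x1, (N1 <= n1)%nat /\
  - b - t / 4 < avg (F n1) (fun g => ind (near r' (e' / 2) (act g x1)))).
{ apply NNPP. intros Hn. assert (b + t / 4 <= b); [|lra]. apply ub.
  exists r', (e' / 2), N1. split; [assumption|]. split; [lra|]. intros n Hn1 x.
  apply Rnot_lt_le. intros Hlt. apply Hn. exists n, x. split; [assumption|lra]. }
destruct H2 as [n1 [x1 [Hn1 Hx1]]].
exists (max N0 N1). intros n Hn x.
assert (H3 := HN0 n ltac:(lia) x).
assert (H4 := HN1 n1 n Hn1 ltac:(lia) x1 x (near r' (e' / 2))).
assert (H5 : avg (F n) (fun g => ind (exists a, near r' (e' / 2) a /\ r' a (act g x) < eta))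
   <= avg (F n) (fun g => ind (near r' e' (act g x)))).
{ apply avg_le; [apply ne|]. intros g _. apply ind_le. intros [z [Hz Hzg]].
  apply (near_mono r' r' e' (e' / 2) z _ eta Hr'); try assumption; try lra. intros; lra. }
assert (H6 : avg (F n) (fun g => ind (near r e (act g x) /\ ~ near r' e' (act g x)))
  + avg (F n) (fun g => ind (near r' e' (act g x))) <= avg (F n) (fun g => ind (near r e (act g x)))).
{ rewrite <- avg_plus. apply avg_le; [apply ne|]. intros g _.
  destruct (classic (near r' e' (act g x))) as [c|c].
  - rewrite (ind_false (_ /\ _)) by tauto. rewrite (ind_true (near r' e' _)) by assumption.
    rewrite ind_true; [lra|].
    apply (near_mono r r' e e' (act g x) _ 0 Hr Hle); try assumption; [|lra].
    rewrite (ps_refl r Hr). lra.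
  - rewrite (ind_false (near r' e' _)) by assumption. rewrite Rplus_0_r. apply ind_le. tauto. }
lra.
Qed.

Lemma ind_union_bound (P : Prop) (m : nat) (Q S : nat -> Prop) :
  (P -> forall t, (t < m)%nat -> Q t \/ S t) ->
  ind P <= ind (forall t, (t < m)%nat -> Q t) + sumL (fun t => ind (S t)) (seq 0 m).
Proof.
intros H.
assert (S0 : 0 <= sumL (fun t => ind (S t)) (seq 0 m)) by (apply sumL_nonneg; intros; apply ind_range).
destruct (classic (forall t, (t < m)%nat -> Q t)) as [HQ|HQ].
- rewrite (ind_true (forall t, _)) by assumption. generalize (ind_range P). lra.
- rewrite (ind_false (forall t, _)) by assumption.
  destruct (classic P) as [p|p]; [|rewrite ind_false by assumption; lra].
  apply not_all_ex_not in HQ. destruct HQ as [t Ht]. apply imply_to_and in Ht. destruct Ht as [Ht Qt].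
  destruct (H p t Ht) as [|St]; [tauto|].
  rewrite Rplus_0_l, (ind_true P), <- (ind_true _ St) by assumption.
  apply (sumL_mem (fun t => ind (S t))); [intros; apply ind_range|]. apply in_seq. lia.
Qed.

(** By invariance of [r], [g h q] stays near whenever [g h p] does, at the coarse scale [e0].
    Passing back to a finer scale loses only the shell, of density at most [t] for each point. The
    map [f] allows one point to have several perturbations. *)
Lemma good_perturb m p m' (f : nat -> nat) : good m p -> (forall t, (t < m')%nat -> (f t < m)%nat) ->
  exists r eta, invariant_pseudometric r /\ 0 < eta /\
  forall q, (forall t, (t < m')%nat -> r (p (f t)) (q t) < eta) -> good m' q.
Proof.
intros [c [Hc Hg]] Hf. assert (ne := Folner_nonempty G F HF).
assert (Hm : 0 < INR m' + 1) by (generalize (pos_INR m'); lra).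
(* Then [m'] shells cost at most [c / 2]; the [+ 1] covers [m' = 0]. *)
set (t := c / (2 * (INR m' + 1))).
assert (Ht : 0 < t) by (apply Rdiv_lt_0_compat; lra).
destruct (near_shell t Ht) as [r [e0 [Hr [He0 Hshell]]]].
exists r, (e0 / 2). split; [assumption|]. split; [lra|]. intros q Hq.
exists (c / 2). split; [lra|]. intros r1 Hr1 e1 He1 N.
set (r' := fun x y => r1 x y + r x y). set (e' := Rmin e1 (e0 / 2)).
assert (Hr' : invariant_pseudometric r') by (apply ps_sum; assumption).
assert (He' : 0 < e') by (apply Rmin_glb_lt; lra).
assert (e'1 : e' <= e1) by apply Rmin_l. assert (e'0 : e' <= e0 / 2) by apply Rmin_r.
assert (le_r : forall x y, r x y <= r' x y).
{ intros x y. unfold r'. generalize (ps_pos r1 Hr1 x y). lra. }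
assert (le_r1 : forall x y, r1 x y <= r' x y).
{ intros x y. unfold r'. generalize (ps_pos r Hr x y). lra. }
destruct (Hshell r' e' Hr' He' le_r) as [N1 HN1]; [lra|].
destruct (Hg r' Hr' e' He' (max N N1)) as [n [Hn [h Hh]]].
exists n. split; [lia|]. exists h.
assert (H : c <= avg (F n) (fun g => ind (forall s, (s < m')%nat -> near r' e' (act g (act h (q s)))))
   + sumL (fun _ => t) (seq 0 m')).
{ eapply Rle_trans; [exact Hh|].
  eapply Rle_trans; [|apply Rplus_le_compat_l; apply sumL_le; intros s _;
     apply (HN1 n ltac:(lia) (act h (q s)))].
  rewrite <- (avg_sumL (fun s g => ind (near r e0 (act g (act h (q s))) /\ ~ near r' e' (act g (act h (q s))))))
     by apply ne.
  rewrite <- avg_plus. apply avg_le; [apply ne|]. intros g _.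
  apply ind_union_bound. intros Hp s Hs.
  destruct (classic (near r' e' (act g (act h (q s))))) as [c1|c1]; [left; exact c1|right].
  split; [|exact c1].
  apply (near_mono r r' e0 e' (act g (act h (p (f s)))) _ (e0 / 2) Hr le_r); [|lra|].
  - rewrite !(ps_act r Hr). left. apply Hq, Hs.
  - apply Hp, Hf, Hs. }
rewrite sumL_const, length_seq in H.
assert (Htm : t * INR m' <= c / 2).
{ apply Rle_trans with (t * (INR m' + 1)).
  - apply Rmult_le_compat_l; lra.
  - right. unfold t. field. lra. }
apply Rle_trans with
  (avg (F n) (fun g => ind (forall s, (s < m')%nat -> near r' e' (act g (act h (q s)))))); [lra|].
apply avg_le; [apply ne|]. intros g _. apply ind_le. intros Hs s Hm'.
apply (near_mono r1 r' e1 e' (act g (act h (q s))) _ 0 Hr1 le_r1); [|lra|apply Hs, Hm'].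
rewrite (ps_refl r1 Hr1). lra.
Qed.

(** * Construction of the independence set *)

(** An index [s < m] codes a word in base [K]; [p s] is interior, in the factor, to the closure of
    the image of [O s]. *)
Definition stage (m : nat) (O : nat -> X -> Prop) (p : nat -> X) : Prop :=
  good m p /\ forall s, (s < m)%nat -> mopen X (O s) /\
  exists r e, invariant_pseudometric r /\ 0 < e /\ forall x, r (p s) x < e -> eqcl (O s) x.

Lemma common_radius m (O : nat -> X -> Prop) p :
  (forall s, (s < m)%nat -> exists r e, invariant_pseudometric r /\ 0 < e /\
     forall x, r (p s) x < e -> eqcl (O s) x) ->
  exists r e, invariant_pseudometric r /\ 0 < e /\
  forall s, (s < m)%nat -> forall x, r (p s) x < e -> eqcl (O s) x.
Proof.
induction m as [|m IH]; intros H.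
- exists (fun _ _ => 0), 1. split; [apply ps_zero|]. split; [lra|]. intros; lia.
- destruct IH as [r [e [Hr [He Hs]]]]; [intros; apply H; lia|].
  destruct (H m (le_n _)) as [r' [e' [Hr' [He' Hm]]]].
  exists (fun x y => r x y + r' x y), (Rmin e e'). split; [apply ps_sum; assumption|].
  split; [apply Rmin_glb_lt; assumption|]. intros s Hsm x Hx.
  assert (H1 := Rlt_le_trans _ _ _ Hx (Rmin_l _ _)). assert (H2 := Rlt_le_trans _ _ _ Hx (Rmin_r _ _)).
  generalize (ps_pos r Hr (p s) x) (ps_pos r' Hr' (p s) x). intros p1 p2.
  destruct (Nat.eq_dec s m) as [->|n]; [apply Hm; lra|]. apply Hs; [lia|lra].
Qed.

Lemma bounded_choice {A : Type} (a0 : A) n (P : nat -> A -> Prop) :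
  (forall t, (t < n)%nat -> exists a, P t a) -> exists f, forall t, (t < n)%nat -> P t (f t).
Proof.
intros H. exists (fun t => epsilon (inhabits a0) (P t)). intros t Ht. apply epsilon_spec, H, Ht.
Qed.

(** The index [t] codes the word [t / K] followed by the letter [t mod K]. The new element is
    [h = h2 g h1^-1]: [h1] brings [E t] back to [O (t / K)], [g] brings [E t] into the closure of
    [U (t mod K)], and [h2] transfers from there into [U (t mod K)]. *)
Lemma stage_step m O p (l : list G) : stage m O p ->
  exists h, ~ In h l /\ exists O' p', stage (m * K) O' p' /\
  forall t, (t < m * K)%nat -> forall x, O' t x -> O (t / K)%nat x /\ U (t mod K)%nat (act h x).
Proof.
intros [Hg HO]. assert (ne := Folner_nonempty G F HF).
set (M := (m * K)%nat).
assert (Hdiv : forall t, (t < M)%nat -> (t / K < m)%nat).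
{ intros t Ht. apply Nat.Div0.div_lt_upper_bound. unfold M in Ht. lia. }
assert (Hmod : forall t, (t < M)%nat -> (t mod K < K)%nat).
{ intros t Ht. apply Nat.mod_upper_bound. unfold M in Ht. lia. }
destruct (good_perturb m p M (fun t => t / K)%nat Hg Hdiv) as [r0 [eta [Hr0 [Heta Hpert]]]].
destruct (common_radius m O p) as [r1 [e1 [Hr1 [He1 Hrad]]]]; [intros s Hs; apply HO, Hs|].
set (r := fun x y => r0 x y + r1 x y). set (e := Rmin eta e1 / 2).
assert (Hr : invariant_pseudometric r) by (apply ps_sum; assumption).
assert (He : 0 < e).
{ assert (0 < Rmin eta e1) by (apply Rmin_glb_lt; assumption). unfold e. lra. }
assert (Hclose : forall x y, r x y < 2 * e -> r0 x y < eta /\ r1 x y < e1).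
{ intros x y. unfold r, e. generalize (ps_pos r0 Hr0 x y) (ps_pos r1 Hr1 x y) (Rmin_l eta e1) (Rmin_r eta e1). lra. }
assert (Hhit : exists g, forall s, (s < m)%nat -> near r e (act g (p s))).
{ destruct Hg as [c [Hc H]]. destruct (H r Hr e He 0%nat) as [n [_ [h Hh]]].
  destruct (avg_ind_pos (F n) (ne n) _ (Rlt_le_trans _ _ _ Hc Hh)) as [g [_ Hgs]].
  exists (gmul G g h). intros s Hs. rewrite acts_mul. apply Hgs, Hs. }
destruct Hhit as [g Hhit].
destruct (bounded_choice (fun _ : X => True) M (fun t E => mopen X E /\ (exists x, E x) /\
  forall x, E x -> eqcl (U (t mod K)%nat) (act g x) /\ r (p (t / K)%nat) x < 2 * e)) as [E HE].
{ intros t Ht.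
  destruct (Hhit _ (Hdiv t Ht) _ (Hmod t Ht)) as [u [Uu Hu]].
  (* Localizing near [g p] before taking an interior point keeps [E t] within [2 e] of [p (t / K)]:
     [e] up to [v] and [e] from there. *)
  set (V := fun x => U (t mod K)%nat x /\ r (act g (p (t / K)%nat)) x < e).
  destruct (eqcl_interior V) as [r' [v [s [Hr' [[Uv Hv] [Hs Hball]]]]]].
  { apply mopen_and; [apply U_open, Hmod, Ht|apply (ps_ball_open r Hr)]. }
  { exists u. split; assumption. }
  exists (fun x => r' v (act g x) < s /\ r v (act g x) < e). split; [|split].
  - apply mopen_and.
    + apply (mopen_act g (fun y => r' v y < s)), (ps_ball_open r' Hr').
    + apply (mopen_act g (fun y => r v y < e)), (ps_ball_open r Hr).
  - exists (act g^-1 v). rewrite actKV, (ps_refl r' Hr'), (ps_refl r Hr). auto.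
  - intros x [H1 H2]. split.
    + apply (eqcl_mono V); [intros y [Vy _]; exact Vy|]. apply Hball, H1.
    + rewrite <- (ps_act r Hr g). generalize (ps_tri r Hr (act g (p (t / K)%nat)) v (act g x)). lra. }
destruct (eqcl_transfer_all M E (fun t => O (t / K)%nat) nil) as [h1 [_ Hh1]].
{ intros t Ht. destruct (HE t Ht) as [oE [nE cE]]. split; [assumption|].
  split; [apply HO, Hdiv, Ht|]. split; [assumption|]. intros x Ex.
  apply (Hrad _ (Hdiv t Ht)). apply Hclose, (cE x Ex). }
set (O1 := fun t x => E t (act h1^-1 x) /\ O (t / K)%nat x).
assert (oO1 : forall t, (t < M)%nat -> mopen X (O1 t)).
{ intros t Ht. apply mopen_and; [apply mopen_act; apply HE, Ht|apply HO, Hdiv, Ht]. }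
set (E2 := fun t x => O1 t (act h1 (act g^-1 x))).
set (k := gmul G g h1^-1).
destruct (eqcl_transfer_all M E2 (fun t => U (t mod K)%nat) (map (fun h => gmul G h k^-1) l))
  as [h2 [Hl Hh2]].
{ intros t Ht. split; [|split; [|split]].
  - apply (mopen_act g^-1 (fun x => O1 t (act h1 x))), mopen_act, oO1, Ht.
  - apply U_open, Hmod, Ht.
  - destruct (Hh1 t Ht) as [x [Ex Ox]]. exists (act g x). unfold E2, O1.
    rewrite !actK. split; assumption.
  - intros x [Ex _]. rewrite actK in Ex.
    rewrite <- (actKV g x). apply (HE t Ht), Ex. }
set (h := gmul G h2 k).
exists h. split.
{ intros Hin. apply Hl. apply in_map_iff. exists h. split; [|assumption].
  unfold h. rewrite <- gmulA, gmulVr, gmul1r. reflexivity. }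
set (O2 := fun t x => O1 t x /\ U (t mod K)%nat (act h x)).
assert (oO2 : forall t, (t < M)%nat -> mopen X (O2 t)).
{ intros t Ht. apply mopen_and; [apply oO1, Ht|]. apply mopen_act, U_open, Hmod, Ht. }
destruct point_exists as [x0 _].
destruct (bounded_choice x0 M (fun t v => O2 t v /\ exists r s, invariant_pseudometric r /\ 0 < s /\
   forall x, r v x < s -> eqcl (O2 t) x)) as [p' Hp'].
{ intros t Ht. destruct (eqcl_interior (O2 t) (oO2 t Ht)) as [r' [v [s [Hr' [Ov [Hs Hball]]]]]].
  - destruct (Hh2 t Ht) as [x [Ex Ux]]. exists (act h1 (act g^-1 x)). split; [exact Ex|].
    unfold h, k. rewrite !acts_mul, actK, actKV. exact Ux.
  - exists v. split; [assumption|]. exists r', s. auto. }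
exists O2, p'. split.
- split.
  (* The points [h1^-1 p'] lie in [E t], hence are small perturbations of the old ones. *)
  + apply (good_act M p' h1^-1). apply Hpert. intros t Ht.
    destruct (Hp' t Ht) as [[[Et _] _] _]. apply Hclose, (HE t Ht), Et.
  + intros t Ht. split; [apply oO2, Ht|apply Hp', Ht].
- intros t Ht x [[_ Ox] Ux]. auto.
Qed.

(** The bound on [sigma] is imposed on all of [G], so that every [sigma] selects a word at each
    later stage as well. *)
Definition independent_list (hs : list G) : Prop :=
  exists m O p, stage m O p /\ forall sigma : G -> nat, (forall g, (sigma g < K)%nat) ->
  exists s, (s < m)%nat /\ forall z, O s z -> forall g, In g hs -> U (sigma g) (act g z).

Lemma independent_extend hs : independent_list hs -> exists h, ~ In h hs /\ independent_list (h :: hs).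
Proof.
intros [m [O [p [Hst Hs]]]]. destruct (stage_step m O p hs Hst) as [h [Hh [O' [p' [Hst' Hsub]]]]].
exists h. split; [assumption|]. exists (m * K)%nat, O', p'. split; [assumption|].
intros sigma HK. destruct (Hs sigma HK) as [s [Hsm Hz]].
assert (HK0 := HK h).
assert (Hdiv : ((s * K + sigma h) / K = s)%nat).
{ rewrite Nat.add_comm, Nat.div_add by lia. rewrite Nat.div_small by assumption. reflexivity. }
assert (Hmod : ((s * K + sigma h) mod K = sigma h)%nat).
{ rewrite Nat.add_comm, Nat.Div0.mod_add. apply Nat.mod_small. assumption. }
assert (Ht : (s * K + sigma h < m * K)%nat) by nia.
exists (s * K + sigma h)%nat. split; [assumption|]. intros z Oz.
specialize (Hsub _ Ht z Oz). rewrite Hdiv, Hmod in Hsub.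
intros g [<-|Hg]; [apply Hsub|]. apply (Hz z); [apply Hsub|assumption].
Qed.

(** Dependent choice along [independent_extend]; the union of the lists is the independence set. *)
Lemma independent_sequence : independent_list nil ->
  exists f : nat -> list G, (forall n, independent_list (f n)) /\
  (forall n, NoDup (f n) /\ length (f n) = n) /\ forall n m, (n <= m)%nat -> incl (f n) (f m).
Proof.
intros H0.
set (T := {hs : list G | independent_list hs}).
assert (Hstep : forall t : T, exists t' : T, exists h, ~ In h (proj1_sig t) /\ proj1_sig t' = h :: proj1_sig t).
{ intros [hs Hhs]. destruct (independent_extend hs Hhs) as [h [Hh Hi]]. exists (exist _ _ Hi), h. auto. }
set (next := fun t => proj1_sig (constructive_indefinite_description _ (Hstep t))).
assert (Hnext : forall t, exists h, ~ In h (proj1_sig t) /\ proj1_sig (next t) = h :: proj1_sig t).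
{ intros t. exact (proj2_sig (constructive_indefinite_description _ (Hstep t))). }
set (f := fix f n := match n with O => exist _ nil H0 : T | S n => next (f n) end).
exists (fun n => proj1_sig (f n)). split; [|split].
- intros n. exact (proj2_sig (f n)).
- induction n as [|n [nd Hl]]; [split; [constructor|reflexivity]|].
  change (f (S n)) with (next (f n)). destruct (Hnext (f n)) as [h [Hh ->]].
  split; [constructor; assumption|simpl; congruence].
- intros n m Hnm. induction Hnm as [|m _ IH]; [apply incl_refl|].
  change (f (S m)) with (next (f m)). destruct (Hnext (f m)) as [h [Hh ->]].
  apply incl_tl, IH.
Qed.

End Independence.

Lemma mean_sensitive_IT K x : mean_sensitive_tuple G X act F K x -> IT_tuple G X act K x.
Proof.
intros Hms U HU. assert (ne := Folner_nonempty G F HF).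
destruct (Hms U HU) as [del [Hdel Hsens]].
assert (U_open : forall k, (k < K)%nat -> mopen X (U k)) by (intros k Hk; apply HU, Hk).
destruct point_exists as [x0 _].
destruct (independent_sequence K U U_open) as [f [Hind [Hnd Hincl]]].
(* The initial stage has the empty word only, with [O] the whole space. *)
{ exists 1%nat, (fun _ _ => True), (fun _ => x0). split; [split|].
  - exists del. split; [assumption|]. intros r Hr e He N.
    (* Sensitivity is applied in the [r]-ball around [x0]: the [y k] then stay [r]-close to [x0]
       under every [g], so visits of the [y k] to the [U k] make [g x0] near. *)
    destruct (Hsens (fun y => r x0 y < e)) as [y [Hy Hlim]].
    { apply (ps_ball_open r Hr). }
    { exists x0. rewrite (ps_refl r Hr). assumption. }
    set (u := fun n => INR (countP (fun g => forall k, (k < K)%nat -> U k (act g (y k))) (F n))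
               / INR (length (F n))) in Hlim.
    assert (Hn : exists n, (N <= n)%nat /\ del < u n).
    { apply NNPP. intros Hn. apply (Rbar_lt_not_le _ _ Hlim).
      rewrite <- (LimSup_seq_const del). apply LimSup_le. exists N. intros n HNn.
      apply Rnot_lt_le. intros Hlt. apply Hn. exists n. auto. }
    destruct Hn as [n [HNn Hun]]. exists n. split; [assumption|]. exists (gone G).
    left. eapply Rlt_le_trans; [exact Hun|].
    unfold u. rewrite <- sumL_ind_countP. fold (avg (F n) (fun g => ind (forall k, (k < K)%nat -> U k (act g (y k))))).
    apply avg_le; [apply ne|]. intros g _. apply ind_le. intros Hk s _ k HkK.
    exists (act g (y k)). split; [apply Hk, HkK|].
    rewrite acts_one, (ps_act r Hr). apply Hy, HkK.
  - intros s _. split; [intros z _; exists 1; split; [lra|auto]|].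
    exists (fun _ _ => 0), 1. split; [apply ps_zero|]. split; [lra|].
    intros z _ r Hr e He. exists z. rewrite (ps_refl r Hr). auto.
  - intros sigma _. exists 0%nat. split; [lia|]. simpl. tauto. }
exists (fun g => exists n, In g (f n)). split.
- intros l. apply NNPP. intros Hn.
  assert (Hl : incl (f (S (length l))) l).
  { intros g Hg. apply NNPP. intros Hgl. apply Hn. exists g. split; [|assumption].
    exists (S (length l)). assumption. }
  destruct (Hnd (S (length l))) as [nd len].
  apply (NoDup_incl_length nd) in Hl. lia.
- intros I sigma HI HJ Hsig.
  assert (HM : exists M, incl I (f M)).
  { clear HI Hsig. induction I as [|g I IH].
    - exists 0%nat. intros g [].
    - destruct IH as [M HM]; [intros h Hh; apply HJ; simpl; auto|].
      destruct (HJ g (or_introl eq_refl)) as [n Hn].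
      exists (max n M). intros h [<-|Hh].
      + apply (Hincl n (max n M)); [lia|assumption].
      + apply (Hincl M (max n M)); [lia|]. apply HM, Hh. }
  destruct HM as [M HM].
  destruct I as [|g0 I']; [tauto|].
  (* Outside the given list [sigma] may exceed [K]; there it is replaced by a value it takes on the
     list. *)
  set (sg := fun g => if excluded_middle_informative (In g (g0 :: I')) then sigma g else sigma g0).
  destruct (Hind M) as [m [O [p [[_ HO] Hs]]]].
  destruct (Hs sg) as [s [Hsm Hz]].
  { intros g. unfold sg. destruct (excluded_middle_informative (In g (g0 :: I'))); apply Hsig; simpl; auto. }
  destruct (HO s Hsm) as [_ [r [e [Hr [He Hball]]]]].
  (* The zero pseudometric reduces membership in [eqcl (O s)] to nonemptiness of [O s]. *)
  destruct (Hball (p s)) with (r := fun _ _ : X => 0) (e := 1) as [z [Oz _]].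
  { rewrite (ps_refl r Hr). assumption. }
  { apply ps_zero. }
  { lra. }
  exists z. intros g Hg. assert (H := Hz z Oz g (HM g Hg)). unfold sg in H.
  destruct (excluded_middle_informative (In g (g0 :: I'))); [assumption|contradiction].
Qed.

End MinimalSystem.

Theorem theorem1p8 (G : Group) (X : MetricSpace) (act : G -> X -> X)
  (F : nat -> list G) :
  countable_group G -> infinite_group G -> amenable G ->
  tds G X act -> minimal_system G X (mopen X) act ->
  Folner G F ->
  local_Bronstein G X act ->
  forall (K : nat) (x : nat -> X), (2 <= K)%nat ->
    mean_sensitive_tuple G X act F K x -> IT_tuple G X act K x.
Proof.
intros _ Hinf _ Htds Hmin HF _ K x _. apply mean_sensitive_IT; assumption.
Qed.
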